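(* Let $M$ be a $(2n+1)$-dimensional $N(\kappa)$-contact metric manifold which is $\varphi$-$\mathcal{T}$-flat, i.e. $g(\mathcal{T}(\varphi X_1,\varphi X_2)\varphi X_3,\varphi X_4)=0$ for all vector fields $X_1,\dots,X_4$, and suppose $C_2=a_0+2na_1+a_2+a_3+a_5+a_6\neq0$. Then $$S=\frac{A_2}{C_2}\,g+\Bigl(2n\kappa-\frac{A_2}{C_2}\Bigr)\eta\otimes\eta,\qquad A_2=a_0\kappa+a_4(2n\kappa-r)+a_7r(1-2n).$$ Therefore $M$ is an $\eta$-Einstein manifold. Consequently, for $\mathcal{T}$ equal to each of the following special tensors (whenever the corresponding $C_2\neq0$), $\varphi$-flatness implies that $S$ has the stated form (so $M$ is Einstein when the $\eta\otimes\eta$ term is absent, and $\eta$-Einstein otherwise): - $\mathcal{C}_\star$: $S=f g+(2n\kappa-f)\eta\otimes\eta$ with $f=\dfrac{\frac{(2n-1)(\kappa+2n-2)(4na_1+a_0)}{2n+1}+a_0\kappa-4n(n-1)a_1}{2a_1(n-1)+a_0}$; - $\mathcal{C}$: $S=(2n-2)g+(2n\kappa-2n+2)\eta\otimes\eta$; - $\mathcal{L}$: $S=((2n-1)\kappa+4n(n-1))g+(\kappa-4n(n-1))\eta\otimes\eta$; - $\mathcal{V}$: $S=fg+(2n\kappa-f)\eta\otimes\eta$ with $f=\frac{2n(2n-3+2\kappa)+2}{2n+1}$; - $\mathcal{P}_\star$: $S=fg+(2n\kappa-f)\eta\otimes\eta$ with $f=\dfrac{\frac{(2n-1)(\kappa+2n-2)(2na_1+a_0)}{2n+1}+\kappa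 a_0}{a_1(2n-1)+a_0}$; - $\mathcal{P},\mathcal{W}_0,\mathcal{W}_1^\star,\mathcal{W}_6,\mathcal{W}_8$: $S=2n\kappa\,g$; - $\mathcal{M}$: $S=\frac{2n(\kappa+n-1)}{n+1}g+\frac{2n(n\kappa-n+1)}{n+1}\eta\otimes\eta$; - $\mathcal{W}_0^\star,\mathcal{W}_1$: $S=\frac{2n\kappa}{4n-1}g+\frac{8n^2\kappa-4n\kappa}{4n-1}\eta\otimes\eta$; - $\mathcal{W}_2,\mathcal{W}_9$: $S=\frac{2n(2n-2+\kappa)}{2n+1}g+\frac{4n(n\kappa-n+1)}{2n+1}\eta\otimes\eta$; - $\mathcal{W}_3$: $S=\frac{2n(\kappa-2n+2)}{2n-1}g+\frac{2n(2n\kappa-2\kappa+2n-2)}{2n-1}\eta\otimes\eta$; - $\mathcal{W}_4,\mathcal{W}_5$: $S=\kappa g+\kappa(2n-1)\eta\otimes\eta$.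
   Context: A contact metric manifold $(M^{2n+1},\varphi,\xi,\eta,g)$ satisfies $\varphi^2=-I+\eta\otimes\xi$, $\eta(\xi)=1$, $\varphi\xi=0$, $\eta\circ\varphi=0$, $g(\varphi X,\varphi Y)=g(X,Y)-\eta(X)\eta(Y)$, $d\eta(X,Y)=g(X,\varphi Y)$; put $h=\tfrac12\mathcal{L}_\xi\varphi$. It is an $N(\kappa)$-contact metric manifold ($\kappa$ a real constant) if $R(X,Y)\xi=\kappa[\eta(Y)X-\eta(X)Y]$ for all $X,Y$, where $R(X,Y)Z=\nabla_X\nabla_YZ-\nabla_Y\nabla_XZ-\nabla_{[X,Y]}Z$. $S$, $Q$, $r$ denote the Ricci tensor, the Ricci operator ($S(X,Y)=g(QX,Y)$) and the scalar curvature. $M$ is $\eta$-Einstein if $S=b_1g+b_2\,\eta\otimes\eta$ with $b_1,b_2$ smooth functions, and Einstein if moreover $b_2=0$. Standing formulas the paper uses for every $N(\kappa)$-contact metric manifold considered: $S(X,Y)=2(n-1)g(X,Y)+2(n-1)g(hX,Y)+[2n\kappa-2(n-1)]\eta(X)\eta(Y)$, $S(X,\xi)=2n\kappa\,\eta(X)$, $r=2n(2n-2+\kappa)$. The $\mathcal{T}$-curvature tensor with coefficients $a_0,\dots,a_7$ (smooth functions on $M$) is $$\mathcal{T}(X_1,X_2)X_3=a_0R(X_1,X_2)X_3+a_1S(X_2,X_3)X_1+a_2S(X_1,X_3)X_2+a_3S(X_1,X_2)X_3+a_4g(X_2,X_3)QX_1+a_5g(X_1,X_3)QX_2+a_6g(X_1,X_2)QX_3+a_7r\bigl(g(X_2,X_3)X_1-g(X_1,X_3)X_2\bigr).$$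 Special cases (coefficients not listed are $0$; $a_0=1$ except for $\mathcal{C}_\star,\mathcal{P}_\star$, where $a_0,a_1$ are free): $\mathcal{C}_\star$ (quasi-conformal): $a_1=-a_2=a_4=-a_5$, $a_7=-\frac1{2n+1}(\frac{a_0}{2n}+2a_1)$; $\mathcal{C}$ (conformal): $a_1=-a_2=a_4=-a_5=-\frac1{2n-1}$, $a_7=\frac1{2n(2n-1)}$; $\mathcal{L}$ (conharmonic): $a_1=-a_2=a_4=-a_5=-\frac1{2n-1}$; $\mathcal{V}$ (concircular): $a_7=-\frac1{2n(2n+1)}$; $\mathcal{P}_\star$ (pseudo-projective): $a_1=-a_2$, $a_7=-\frac1{2n+1}(\frac{a_0}{2n}+a_1)$; $\mathcal{P}$ (projective): $a_1=-a_2=-\frac1{2n}$; $\mathcal{M}$ ($M$-projective): $a_1=-a_2=a_4=-a_5=-\frac1{4n}$; $\mathcal{W}_0$: $a_1=-a_5=-\frac1{2n}$; $\mathcal{W}_0^\star$: $a_1=-a_5=\frac1{2n}$; $\mathcal{W}_1$: $a_1=-a_2=\frac1{2n}$; $\mathcal{W}_1^\star$: $a_1=-a_2=-\frac1{2n}$; $\mathcal{W}_2$: $a_4=-a_5=-\frac1{2n}$; $\mathcal{W}_3$: $a_2=-a_4=-\frac1{2n}$; $\mathcal{W}_4$: $a_5=-a_6=\frac1{2n}$; $\mathcal{W}_5$: $a_2=-a_5=-\frac1{2n}$; $\mathcal{W}_6$: $a_1=-a_6=-\frac1{2n}$; $\mathcal{W}_8$: $a_1=-a_3=-\frac1{2n}$;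 $\mathcal{W}_9$: $a_3=-a_4=\frac1{2n}$. *)

(* Defs.v *)
From HB Require Import structures.
From mathcomp Require Import all_boot all_order all_algebra.
From mathcomp Require Import all_classical all_reals all_analysis.
Set Implicit Arguments.
Unset Strict Implicit.
Unset Printing Implicit Defensive.
Import Order.TTheory GRing.Theory Num.Theory.
Import numFieldNormedType.Exports.
Local Open Scope classical_set_scope.
Local Open Scope ring_scope.

(* [iter_partial [:: i1; ...; ik] F] is the iterated partial derivative
   d_i1 ... d_ik F. *)
Definition iter_partial (R : realType) (m : nat) (s : seq 'I_m)
    (F : 'rV[R]_m -> R) : 'rV[R]_m -> R :=
  foldr (fun i G => fun x => 'D_('e_i) G x) F s.

(* C^oo on an open set U: all iterated partial derivatives are (Frechet)
   differentiable at every point of U.  The values of F outside U are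
   irrelevant. *)
Definition smooth_on (R : realType) (m : nat) (U : set 'rV[R]_m)
    (F : 'rV[R]_m -> R) : Prop :=
  forall (s : seq 'I_m) (x : 'rV[R]_m), U x -> differentiable (iter_partial s F) x.

(* A Hausdorff second countable smooth manifold of dimension m with an atlas.
   [coord c] and its inverse [param c] are total functions, which are only
   meaningful on [dom c] and on [coord c @` dom c] respectively. *)
Record manifold (R : realType) (m : nat) := Manifold {
  carrier :> topologicalType;
  atlas : Type;
  dom : atlas -> set carrier;
  coord : atlas -> carrier -> 'rV[R]_m;
  param : atlas -> 'rV[R]_m -> carrier;
  manifold_hausdorff : hausdorff_space carrier;
  manifold_second_countable : @second_countable carrier;
  dom_open : forall c, open (dom c);
  dom_cover : forall p, exists c, dom c p;
  coord_open : forall c, open (coord c @` dom c);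
  coordK : forall c p, dom c p -> param c (coord c p) = p;
  coord_continuous : forall c, {within dom c, continuous (coord c)};
  param_continuous : forall c, {within coord c @` dom c, continuous (param c)};
  transition_smooth : forall c d (i : 'I_m),
    smooth_on (coord c @` (dom c `&` dom d))
              (fun x => coord d (param c x) 0 i)
}.

Arguments dom {R m M} c : rename.
Arguments coord {R m M} c p : rename.
Arguments param {R m M} c x : rename.

Definition smooth_in (R : realType) (m : nat) (M : manifold R m) (c : atlas M)
    (f : M -> R) : Prop :=
  smooth_on (coord c @` dom c) (fun x => f (param c x)).

Definition smooth (R : realType) (m : nat) (M : manifold R m) (f : M -> R) : Prop :=
  forall c : atlas M, smooth_in c f.

(* Tangent vectors at p are given by their components in the charts around p:
   [X c p] is the row vector of components of X at p in the chart c, and is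
   only meaningful for p in [dom c].  Accordingly, the operations below take
   the chart c in which they are computed as an argument. *)
Definition field (R : realType) (m : nat) (M : manifold R m) : Type :=
  atlas M -> M -> 'rV[R]_m.

(* Jacobian matrix at p of the transition from the chart c to the chart d, with
   the convention of [jacobian]: it acts on row vectors from the right, so that
   components transform by X d p = X c p *m transition c d p. *)
Definition transition (R : realType) (m : nat) (M : manifold R m)
    (c d : atlas M) (p : M) : 'M[R]_m :=
  jacobian (fun x => coord d (param c x)) (coord c p).

Definition vector_field (R : realType) (m : nat) (M : manifold R m)
    (X : field M) : Prop :=
  (forall c (i : 'I_m), smooth_in c (fun p => X c p 0 i)) /\
  (forall c d p, dom c p -> dom d p -> X d p = X c p *m transition c d p).

(* d_i f at p, in the coordinates of the chart c *)
Definition partial (R : realType) (m : nat) (M : manifold R m) (c : atlas M)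
    (i : 'I_m) (f : M -> R) (p : M) : R :=
  'D_('e_i) (fun x => f (param c x)) (coord c p).

(* X f at p *)
Definition along (R : realType) (m : nat) (M : manifold R m) (c : atlas M)
    (X : field M) (f : M -> R) (p : M) : R :=
  \sum_i X c p 0 i * partial c i f p.

Definition bracket (R : realType) (m : nat) (M : manifold R m)
    (X Y : field M) : field M :=
  fun c p => \row_k (along c X (fun q => Y c q 0 k) p
                     - along c Y (fun q => X c q 0 k) p).

(* The i-th coordinate vector field of whichever chart is being used; it is not
   a global vector field, and serves to compute traces in a chart. *)
Definition coord_field (R : realType) (m : nat) (M : manifold R m) (i : 'I_m) :
    field M :=
  fun _ _ => 'e_i.

Arguments coord_field {R m} M i.

(* The tensor fields (phi, xi, eta, g) of a contact metric structure, by
   components.  With row vectors u, v of components of tangent vectors: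
   phi(u) = u *m phi c p, eta(u) = u *m eta c p, g(u, v) = u *m g c p *m v^T. *)
Record contact_data (R : realType) (m : nat) (M : manifold R m) := ContactData {
  phi : atlas M -> M -> 'M[R]_m;
  xi : field M;
  eta : atlas M -> M -> 'cV[R]_m;
  g : atlas M -> M -> 'M[R]_m
}.

Definition tensor_fields (R : realType) (m : nat) (M : manifold R m)
    (K : contact_data M) : Prop :=
  [/\ forall c, [/\ forall i j, smooth_in c (fun p => phi K c p i j),
                    forall i, smooth_in c (fun p => eta K c p i 0)
                  & forall i j, smooth_in c (fun p => g K c p i j)],
      vector_field (xi K)
    & forall c d p, dom c p -> dom d p ->
        [/\ phi K c p *m transition c d p = transition c d p *m phi K d p,
            eta K c p = transition c d p *m eta K d p
          & g K c p = transition c d p *m g K d p *m (transition c d p)^T]].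

Definition metric (R : realType) (m : nat) (M : manifold R m)
    (K : contact_data M) (X Y : field M) (c : atlas M) (p : M) : R :=
  (X c p *m g K c p *m (Y c p)^T) 0 0.

Definition eta_of (R : realType) (m : nat) (M : manifold R m)
    (K : contact_data M) (X : field M) (c : atlas M) (p : M) : R :=
  (X c p *m eta K c p) 0 0.

Definition phi_of (R : realType) (m : nat) (M : manifold R m)
    (K : contact_data M) (X : field M) : field M :=
  fun c p => X c p *m phi K c p.

Definition riemannian (R : realType) (m : nat) (M : manifold R m)
    (K : contact_data M) : Prop :=
  forall c p, dom c p ->
    (g K c p)^T = g K c p /\
    (forall v : 'rV[R]_m, v != 0 -> 0 < (v *m g K c p *m v^T) 0 0).

(* The convention d eta(X, Y) = (X eta(Y) - Y eta(X) - eta([X, Y])) / 2 of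
   contact metric geometry, for which Sasakian manifolds have kappa = 1. *)
Definition d_eta (R : realType) (m : nat) (M : manifold R m)
    (K : contact_data M) (X Y : field M) (c : atlas M) (p : M) : R :=
  2^-1 * (along c X (eta_of K Y c) p - along c Y (eta_of K X c) p
          - eta_of K (bracket X Y) c p).

Definition contact_metric (R : realType) (m : nat) (M : manifold R m)
    (K : contact_data M) : Prop :=
  [/\ tensor_fields K,
      riemannian K,
      forall c p, dom c p ->
        [/\ phi K c p *m phi K c p = - 1%:M + eta K c p *m xi K c p,
            eta_of K (xi K) c p = 1,
            phi_of K (xi K) c p = 0
          & phi K c p *m eta K c p = 0],
      forall X Y, vector_field X -> vector_field Y ->
        forall c p, dom c p ->
          metric K (phi_of K X) (phi_of K Y) c p
          = metric K X Y c p - eta_of K X c p * eta_of K Y c p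
    & forall X Y, vector_field X -> vector_field Y ->
        forall c p, dom c p -> d_eta K X Y c p = metric K X (phi_of K Y) c p].

(* Christoffel symbol Gamma^k_ij of the Levi-Civita connection of g *)
Definition christoffel (R : realType) (m : nat) (M : manifold R m)
    (K : contact_data M) (c : atlas M) (p : M) (k i j : 'I_m) : R :=
  2^-1 * \sum_l invmx (g K c p) k l *
    (partial c i (fun q => g K c q j l) p
     + partial c j (fun q => g K c q i l) p
     - partial c l (fun q => g K c q i j) p).

Definition nabla (R : realType) (m : nat) (M : manifold R m)
    (K : contact_data M) (X Y : field M) : field M :=
  fun c p => \row_k (along c X (fun q => Y c q 0 k) p
    + \sum_i \sum_j christoffel K c p k i j * X c p 0 i * Y c p 0 j).

Definition curvature (R : realType) (m : nat) (M : manifold R m)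
    (K : contact_data M) (X Y Z : field M) : field M :=
  fun c p => nabla K X (nabla K Y Z) c p - nabla K Y (nabla K X Z) c p
             - nabla K (bracket X Y) Z c p.

(* S(X, Y) is the trace of Z |-> R(Z, X)Y *)
Definition ricci (R : realType) (m : nat) (M : manifold R m)
    (K : contact_data M) (X Y : field M) (c : atlas M) (p : M) : R :=
  \sum_i curvature K (coord_field M i) X Y c p 0 i.

(* The Ricci operator, obtained from S by raising an index *)
Definition ricci_op (R : realType) (m : nat) (M : manifold R m)
    (K : contact_data M) (X : field M) : field M :=
  fun c p => (\row_j ricci K X (coord_field M j) c p) *m invmx (g K c p).

(* r is the scalar curvature, i.e. the trace of the Ricci operator *)
Definition scalar_curvature (R : realType) (m : nat) (M : manifold R m)
    (K : contact_data M) (r : M -> R) : Prop :=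
  forall c p, dom c p -> r p = \sum_i ricci_op K (coord_field M i) c p 0 i.

Definition N_contact_metric (R : realType) (m : nat) (M : manifold R m)
    (K : contact_data M) (kappa : R) : Prop :=
  contact_metric K /\
  forall X Y, vector_field X -> vector_field Y ->
    forall c p, dom c p ->
      curvature K X Y (xi K) c p
      = kappa *: (eta_of K Y c p *: X c p - eta_of K X c p *: Y c p).

Definition ricci_form (R : realType) (m : nat) (M : manifold R m)
    (K : contact_data M) (b1 b2 : M -> R) : Prop :=
  forall X Y, vector_field X -> vector_field Y ->
    forall c p, dom c p ->
      ricci K X Y c p
      = b1 p * metric K X Y c p + b2 p * (eta_of K X c p * eta_of K Y c p).

Definition eta_einstein (R : realType) (m : nat) (M : manifold R m)
    (K : contact_data M) : Prop :=
  exists b1 b2 : M -> R, [/\ smooth b1, smooth b2 & ricci_form K b1 b2].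

Definition einstein (R : realType) (m : nat) (M : manifold R m)
    (K : contact_data M) : Prop :=
  exists b1 b2 : M -> R,
    [/\ smooth b1, smooth b2, ricci_form K b1 b2 & forall p, b2 p = 0].

Record coefs (R : realType) (m : nat) (M : manifold R m) := Coefs {
  a0 : M -> R; a1 : M -> R; a2 : M -> R; a3 : M -> R;
  a4 : M -> R; a5 : M -> R; a6 : M -> R; a7 : M -> R
}.

Definition smooth_coefs (R : realType) (m : nat) (M : manifold R m)
    (a : coefs M) : Prop :=
  [/\ smooth (a0 a), smooth (a1 a), smooth (a2 a) & smooth (a3 a)] /\
  [/\ smooth (a4 a), smooth (a5 a), smooth (a6 a) & smooth (a7 a)].

Definition T_curvature (R : realType) (m : nat) (M : manifold R m)
    (K : contact_data M) (r : M -> R) (a : coefs M) (X1 X2 X3 : field M) :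
    field M :=
  fun c p =>
    a0 a p *: curvature K X1 X2 X3 c p
    + (a1 a p * ricci K X2 X3 c p) *: X1 c p
    + (a2 a p * ricci K X1 X3 c p) *: X2 c p
    + (a3 a p * ricci K X1 X2 c p) *: X3 c p
    + (a4 a p * metric K X2 X3 c p) *: ricci_op K X1 c p
    + (a5 a p * metric K X1 X3 c p) *: ricci_op K X2 c p
    + (a6 a p * metric K X1 X2 c p) *: ricci_op K X3 c p
    + (a7 a p * r p) *: (metric K X2 X3 c p *: X1 c p
                         - metric K X1 X3 c p *: X2 c p).

Definition phi_T_flat (R : realType) (m : nat) (M : manifold R m)
    (K : contact_data M) (r : M -> R) (a : coefs M) : Prop :=
  forall X1 X2 X3 X4, vector_field X1 -> vector_field X2 ->
    vector_field X3 -> vector_field X4 ->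
    forall c p, dom c p ->
      metric K (T_curvature K r a (phi_of K X1) (phi_of K X2) (phi_of K X3))
               (phi_of K X4) c p = 0.

Definition C2 (R : realType) (n m : nat) (M : manifold R m) (a : coefs M)
    (p : M) : R :=
  a0 a p + 2 * n%:R * a1 a p + a2 a p + a3 a p + a5 a p + a6 a p.

Definition A2 (R : realType) (n m : nat) (M : manifold R m) (kappa : R)
    (r : M -> R) (a : coefs M) (p : M) : R :=
  a0 a p * kappa + a4 a p * (2 * n%:R * kappa - r p)
  + a7 a p * r p * (1 - 2 * n%:R).

(* For the particular tensors below: phi-flatness forces the Ricci tensor to be
   b1 g + b2 eta (x) eta, when C2 vanishes nowhere. *)
Definition flat_gives_eta_einstein (R : realType) (n m : nat) (M : manifold R m)
    (K : contact_data M) (r : M -> R) (a : coefs M) (b1 b2 : M -> R) : Prop :=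
  (forall p, C2 n a p != 0) -> phi_T_flat K r a ->
  ricci_form K b1 b2 /\ eta_einstein K.

Definition flat_gives_einstein (R : realType) (n m : nat) (M : manifold R m)
    (K : contact_data M) (r : M -> R) (a : coefs M) (b : M -> R) : Prop :=
  (forall p, C2 n a p != 0) -> phi_T_flat K r a ->
  ricci_form K b (fun=> 0) /\ einstein K.

Definition const_coefs (R : realType) (m : nat) (M : manifold R m)
    (c0 c1 c2 c3 c4 c5 c6 c7 : R) : coefs M :=
  Coefs (fun=> c0) (fun=> c1) (fun=> c2) (fun=> c3)
        (fun=> c4) (fun=> c5) (fun=> c6) (fun=> c7).

Definition quasi_conformal (R : realType) (n m : nat) (M : manifold R m)
    (f0 f1 : M -> R) : coefs M :=
  Coefs f0 f1 (fun p => - f1 p) (fun=> 0) f1 (fun p => - f1 p) (fun=> 0)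
    (fun p => - (2 * n%:R + 1)^-1 * (f0 p / (2 * n%:R) + 2 * f1 p)).

Definition conformal (R : realType) (n m : nat) (M : manifold R m) : coefs M :=
  let t : R := (2 * n%:R - 1)^-1 in
  const_coefs M 1 (- t) t 0 (- t) t 0 (2 * n%:R * (2 * n%:R - 1))^-1.

Definition conharmonic (R : realType) (n m : nat) (M : manifold R m) : coefs M :=
  let t : R := (2 * n%:R - 1)^-1 in
  const_coefs M 1 (- t) t 0 (- t) t 0 0.

Definition concircular (R : realType) (n m : nat) (M : manifold R m) : coefs M :=
  const_coefs M 1 0 0 0 0 0 0 (- (2 * n%:R * (2 * n%:R + 1))^-1).

Definition pseudo_projective (R : realType) (n m : nat) (M : manifold R m)
    (f0 f1 : M -> R) : coefs M :=
  Coefs f0 f1 (fun p => - f1 p) (fun=> 0) (fun=> 0) (fun=> 0) (fun=> 0)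
    (fun p => - (2 * n%:R + 1)^-1 * (f0 p / (2 * n%:R) + f1 p)).

Definition projective (R : realType) (n m : nat) (M : manifold R m) : coefs M :=
  let t : R := (2 * n%:R)^-1 in const_coefs M 1 (- t) t 0 0 0 0 0.

Definition M_projective (R : realType) (n m : nat) (M : manifold R m) : coefs M :=
  let t : R := (4 * n%:R)^-1 in const_coefs M 1 (- t) t 0 (- t) t 0 0.

Definition W0 (R : realType) (n m : nat) (M : manifold R m) : coefs M :=
  let t : R := (2 * n%:R)^-1 in const_coefs M 1 (- t) 0 0 0 t 0 0.

Definition W0_star (R : realType) (n m : nat) (M : manifold R m) : coefs M :=
  let t : R := (2 * n%:R)^-1 in const_coefs M 1 t 0 0 0 (- t) 0 0.

Definition W1 (R : realType) (n m : nat) (M : manifold R m) : coefs M :=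
  let t : R := (2 * n%:R)^-1 in const_coefs M 1 t (- t) 0 0 0 0 0.

Definition W1_star (R : realType) (n m : nat) (M : manifold R m) : coefs M :=
  let t : R := (2 * n%:R)^-1 in const_coefs M 1 (- t) t 0 0 0 0 0.

Definition W2 (R : realType) (n m : nat) (M : manifold R m) : coefs M :=
  let t : R := (2 * n%:R)^-1 in const_coefs M 1 0 0 0 (- t) t 0 0.

Definition W3 (R : realType) (n m : nat) (M : manifold R m) : coefs M :=
  let t : R := (2 * n%:R)^-1 in const_coefs M 1 0 (- t) 0 t 0 0 0.

Definition W4 (R : realType) (n m : nat) (M : manifold R m) : coefs M :=
  let t : R := (2 * n%:R)^-1 in const_coefs M 1 0 0 0 0 t (- t) 0.

Definition W5 (R : realType) (n m : nat) (M : manifold R m) : coefs M :=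
  let t : R := (2 * n%:R)^-1 in const_coefs M 1 0 (- t) 0 0 t 0 0.

Definition W6 (R : realType) (n m : nat) (M : manifold R m) : coefs M :=
  let t : R := (2 * n%:R)^-1 in const_coefs M 1 (- t) 0 0 0 0 t 0.

Definition W8 (R : realType) (n m : nat) (M : manifold R m) : coefs M :=
  let t : R := (2 * n%:R)^-1 in const_coefs M 1 (- t) 0 t 0 0 0 0.

Definition W9 (R : realType) (n m : nat) (M : manifold R m) : coefs M :=
  let t : R := (2 * n%:R)^-1 in const_coefs M 1 0 0 t (- t) 0 0 0.

(* Main.v *)
From HB Require Import structures.
Require Import Defs.
From mathcomp Require Import all_boot all_order all_algebra.
From mathcomp Require Import all_classical all_reals all_analysis.
From mathcomp Require Import ring lra.
Set Implicit Arguments.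
Unset Strict Implicit.
Unset Printing Implicit Defensive.
Import Order.TTheory GRing.Theory Num.Theory.
Import numFieldNormedType.Exports.
Local Open Scope classical_set_scope.
Local Open Scope ring_scope.

(** Write [S] for the Ricci tensor, [g] for the metric and [T] for the
T-curvature.  The identity is a contraction of the flatness condition over the
contact hyperplane [ker eta], carried out at one point in one chart.

As [phi ^ 2 = - id] on [ker eta], flatness says that [T(u, v) w] is a multiple
of [xi] for all [u], [v], [w] in [ker eta] ([T_op_horizontal]).  Hence for fixed
horizontal [v], [w] the endomorphism [u |-> T(u, v) w] has no trace along
[ker eta], that is, its full trace equals [eta(T(xi, v) w)]
([horizontal_trace]).  The trace of each term of [T] is a multiple of [S(v, w)]
or of [g(v, w)] ([trace_T_op]), and so is [eta(T(xi, v) w)], because the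
N(kappa) condition and the skewness of the curvature give
[eta(R(xi, v) w) = kappa g(v, w)] ([ev_T_op]).  What is left is
[C2 S(v, w) = A2 g(v, w)] on [ker eta] ([horizontal_ricci]).  In the direction of
[xi], contracting the N(kappa) condition gives [S(v, xi) = 2 n kappa eta(v)]
([ric_xi]), and [S] is symmetric ([ric_mx_sym]), which determines [S]
([flat_ricci]).

Two things have to be supplied to make this pointwise argument legitimate.

First, the curvature must be a tensor with the classical symmetries.  In a chart
the Levi-Civita connection is given by matrices [conn_mx], and the curvature by
matrices [curv_mx] acting on the components of the third argument
([cov_commutator], [curvatureE]).  That the derivatives of the arguments cancel,
and that the curvature is skew with respect to the metric ([curv_mx_skew]),
both rest on the symmetry of second derivatives ([derive_comm]); the first
Bianchi identity ([curv_mx_bianchi]) comes from the absence of torsion.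

Secondly, flatness, the N(kappa) condition and the compatibility of the metric
are assumed for global vector fields, whereas the contraction needs them for
arbitrary tangent vectors at a point.  Cutting off a constant field of a chart
by a smooth bump function shows that every tangent vector extends to a global
vector field ([vector_field_through]).  The bump function is built from
[exp(- 1 / s)], and the Hausdorff property makes the extension by zero smooth.

That [M] is eta-Einstein also requires [A2 / C2] to be smooth, which reduces to
the smoothness of the scalar curvature ([smooth_in_scalar_curvature]).  The
special tensors are obtained by evaluating [A2] and [C2]. *)

(** * Smooth functions on open subsets of coordinate space *)

(** The difference of the two functions vanishes near [x], hence has the zero
map as its differential there. *)
Lemma near_eq_differentiable (R : realType) (V W : normedModType R)
    (f h : V -> W) (x : V) :
  (\forall y \near x, f y = h y) -> differentiable f x -> differentiable h x.
Proof.
move=> fh df.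
have d0 : differentiable (h - f) x.
  have e0 : (h - f) \o shift x = cst ((h - f) x) + (\0 : V -> W) +o_ 0 id.
    apply/eqaddoP => _ /posnumP[e].
    have fhx := nbhs_singleton fh.
    have : \forall y \near (0 : V), f (y + x) = h (y + x).
      by move: fh; rewrite (near_shift 0 x) /=; apply: filterS => y; rewrite subr0.
    apply: filterS => y fhy.
    rewrite /= !fctE /cst /= /shift /= fhy fhx !subrr addr0 subr0 normr0.
    by rewrite mulr_ge0.
  have D := @diff_unique _ _ _ _ \0 _ (@cst_continuous _ _ 0) e0.
  apply/diff_locallyP; split; first by rewrite D; exact: (@cst_continuous _ _ 0).
  by rewrite D.
have -> : h = f + (h - f) by rewrite addrC subrK.
exact: differentiableD.
Qed.

(** Differentiability of all iterated partial derivatives up to order [k].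
Recursion on the order allows inductive proofs of the product and chain rules,
in which the derivatives of a product or composite are again of that kind. *)
Fixpoint diff_upto (R : realType) (m k : nat) (U : set 'rV[R]_m)
    (F : 'rV[R]_m -> R) : Prop :=
  (forall x, U x -> differentiable F x) /\
  (if k is k'.+1 then forall i : 'I_m, diff_upto k' U (fun x => 'D_('e_i) F x)
   else True).

Lemma iter_partial_rcons (R : realType) m (s : seq 'I_m) i (F : 'rV[R]_m -> R) :
  iter_partial (rcons s i) F = iter_partial s (fun x => 'D_('e_i) F x).
Proof. by rewrite /iter_partial foldr_rcons. Qed.

Lemma smooth_onP (R : realType) m (U : set 'rV[R]_m) F :
  smooth_on U F <-> forall k, diff_upto k U F.
Proof.
split=> [+ k|].
  elim: k F => [|k IH] F sF /=; first by split=> // x Ux; exact: (sF [::]).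
  split=> [x Ux|i]; first exact: (sF [::]).
  by apply: IH => s x Ux; rewrite -iter_partial_rcons; exact: sF.
move=> dF s; elim/last_ind: s F dF => [|s i IH] F dF x Ux.
  exact: (dF 0%N).1.
by rewrite iter_partial_rcons; apply: IH => // k; exact: (dF k.+1).2.
Qed.

Section smooth_functions.
Context {R : realType} {m : nat}.
Variable (U : set 'rV[R]_m).
Implicit Types (F G : 'rV[R]_m -> R).

Lemma smooth_on_diff F x : smooth_on U F -> U x -> differentiable F x.
Proof. by move=> sF; exact: (sF [::]). Qed.

Lemma smooth_on_partial F i :
  smooth_on U F -> smooth_on U (fun x => 'D_('e_i) F x).
Proof. by move=> sF s x Ux; rewrite -iter_partial_rcons; exact: sF. Qed.

Lemma diff_uptoW k F : diff_upto k.+1 U F -> diff_upto k U F.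
Proof.
elim: k F => [|k IH] F [dF DF] //; split=> // i.
by apply: IH; exact: DF.
Qed.

Lemma smooth_on_local F :
  (forall x, U x -> exists2 V : set 'rV[R]_m, V x & smooth_on V F) ->
  smooth_on U F.
Proof. by move=> lF s x /lF [V Vx]; exact. Qed.

Lemma diff_upto_cst k c : diff_upto k U (fun=> c).
Proof.
elim: k c => [|k IH] c; 
  (split; [move=> x _; exact: differentiable_cst|move=> // i]).
have -> : (fun x => 'D_('e_i) (fun=> c) x) = (fun=> 0) :> ('rV[R]_m -> R).
  by apply/funext => x; exact: derive_cst.
exact: IH.
Qed.

Hypothesis oU : open U.

Lemma diff_upto_eq k F G :
  {in U, F =1 G} -> diff_upto k U F -> diff_upto k U G.
Proof.
have nearU F1 G1 x : {in U, F1 =1 G1} -> U x -> \forall y \near x, F1 y = G1 y.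
  move=> FG Ux; apply: filterS (open_nbhs_nbhs (conj oU Ux)) => y Uy.
  by apply: FG; rewrite inE.
elim: k F G => [|k IH] F G FG [dF DF]; 
  (split; [move=> x Ux|move=> // i]).
- exact: near_eq_differentiable (nearU _ _ _ FG Ux) (dF _ Ux).
- exact: near_eq_differentiable (nearU _ _ _ FG Ux) (dF _ Ux).
apply: IH (DF i) => x; rewrite inE => Ux.
exact: near_eq_derive (nearU _ _ _ FG Ux).
Qed.

Lemma diff_uptoD k F G :
  diff_upto k U F -> diff_upto k U G -> diff_upto k U (fun x => F x + G x).
Proof.
elim: k F G => [|k IH] F G [dF DF] [dG DG];
  (split; [move=> x Ux|move=> // i]).
- by apply: (@differentiableD _ _ _ F G); [exact: dF|exact: dG].
- by apply: (@differentiableD _ _ _ F G); [exact: dF|exact: dG].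
apply: diff_upto_eq (IH _ _ (DF i) (DG i)) => x; rewrite inE => Ux.
by rewrite (@deriveD _ _ _ F G)//; apply: diff_derivable; [exact: dF|exact: dG].
Qed.

Lemma diff_uptoM k F G :
  diff_upto k U F -> diff_upto k U G -> diff_upto k U (fun x => F x * G x).
Proof.
elim: k F G => [|k IH] F G FU GU; have [dF DF] := FU; have [dG DG] := GU;
  (split; [move=> x Ux|move=> // i]).
- by apply: (@differentiableM _ _ F G); [exact: dF|exact: dG].
- by apply: (@differentiableM _ _ F G); [exact: dF|exact: dG].
have H : diff_upto k U (fun x => F x * 'D_('e_i) G x + G x * 'D_('e_i) F x).
  by apply: diff_uptoD; apply: IH; [exact: diff_uptoW|exact: DG
                                   |exact: diff_uptoW|exact: DF].
apply: diff_upto_eq H => x; rewrite inE => Ux.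
by rewrite (@deriveM _ _ F G)//; apply: diff_derivable; [exact: dF|exact: dG].
Qed.

Lemma diff_uptoV k F : {in U, forall x, F x != 0} ->
  diff_upto k U F -> diff_upto k U (fun x => (F x)^-1).
Proof.
move=> F0; elim: k => [|k IH] FU; have [dF DF] := FU;
  (split; [move=> x Ux|move=> // i]).
- by apply: (@differentiableV _ _ F); [exact: dF|apply: F0; rewrite inE].
- by apply: (@differentiableV _ _ F); [exact: dF|apply: F0; rewrite inE].
have Fk := IH (diff_uptoW FU).
have H : diff_upto k U (fun x => -1 * ((F x)^-1 * (F x)^-1) * 'D_('e_i) F x).
  apply: diff_uptoM; last exact: DF.
  by apply: diff_uptoM; [exact: diff_upto_cst|exact: diff_uptoM].
apply: diff_upto_eq H => x xU; have Ux := set_mem xU.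
rewrite (@deriveV _ _ F) //; [|exact: F0|by apply: diff_derivable; exact: dF].
by rewrite mulN1r -invfM -expr2.
Qed.

Lemma smooth_on_eq F G : {in U, F =1 G} -> smooth_on U F -> smooth_on U G.
Proof. by move=> FG /smooth_onP sF; apply/smooth_onP => k; exact: diff_upto_eq (sF k). Qed.

Lemma smooth_on_cst c : smooth_on U (fun=> c).
Proof. by apply/smooth_onP => k; exact: diff_upto_cst. Qed.

Lemma smooth_onD F G :
  smooth_on U F -> smooth_on U G -> smooth_on U (fun x => F x + G x).
Proof.
by move=> /smooth_onP sF /smooth_onP sG; apply/smooth_onP => k; exact: diff_uptoD.
Qed.

Lemma smooth_onM F G :
  smooth_on U F -> smooth_on U G -> smooth_on U (fun x => F x * G x).
Proof.
by move=> /smooth_onP sF /smooth_onP sG; apply/smooth_onP => k; exact: diff_uptoM.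
Qed.

Lemma smooth_onV F : {in U, forall x, F x != 0} ->
  smooth_on U F -> smooth_on U (fun x => (F x)^-1).
Proof.
by move=> F0 /smooth_onP sF; apply/smooth_onP => k; exact: diff_uptoV.
Qed.

Lemma smooth_onN F : smooth_on U F -> smooth_on U (fun x => - F x).
Proof.
move=> sF; apply: smooth_on_eq (smooth_onM (smooth_on_cst (-1)) sF) => x _.
exact: mulN1r.
Qed.

Lemma smooth_onB F G :
  smooth_on U F -> smooth_on U G -> smooth_on U (fun x => F x - G x).
Proof. by move=> sF sG; apply: smooth_onD => //; exact: smooth_onN. Qed.

Lemma smooth_on_sum (I : Type) (r : seq I) (P : pred I) (F : I -> 'rV[R]_m -> R) :
  (forall i, P i -> smooth_on U (F i)) ->
  smooth_on U (fun x => \sum_(i <- r | P i) F i x).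
Proof.
move=> sF; elim: r => [|i r IH].
  by apply: smooth_on_eq (smooth_on_cst 0) => x _; rewrite big_nil.
have [Pi|nPi] := boolP (P i).
  by apply: smooth_on_eq (smooth_onD (sF i Pi) IH) => x _; rewrite big_cons Pi.
by apply: smooth_on_eq IH => x _; rewrite big_cons (negPf nPi).
Qed.

Lemma smooth_on_prod (I : Type) (r : seq I) (P : pred I) (F : I -> 'rV[R]_m -> R) :
  (forall i, P i -> smooth_on U (F i)) ->
  smooth_on U (fun x => \prod_(i <- r | P i) F i x).
Proof.
move=> sF; elim: r => [|i r IH].
  by apply: smooth_on_eq (smooth_on_cst 1) => x _; rewrite big_nil.
have [Pi|nPi] := boolP (P i).
  by apply: smooth_on_eq (smooth_onM (sF i Pi) IH) => x _; rewrite big_cons Pi.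
by apply: smooth_on_eq IH => x _; rewrite big_cons (negPf nPi).
Qed.

End smooth_functions.

Section smooth_maps.
Context {R : realType} {m p : nat}.

Lemma differentiable_mx n q (V : normedModType R) (T : V -> 'M[R]_(n, q)) x :
  (forall i j, differentiable (fun y => T y i j) x) -> differentiable T x.
Proof.
move=> dT.
have -> : T = \sum_(i < n) \sum_(j < q) (fun y => T y i j *: delta_mx i j).
  apply/funext => y; rewrite fct_sumE [LHS]matrix_sum_delta.
  by apply: eq_bigr => i _; rewrite fct_sumE.
apply: differentiable_sum => i; apply: differentiable_sum => j.
exact: differentiableZl.
Qed.

Lemma derive_comp_rV (F : 'rV[R]_p -> R) (T : 'rV[R]_m -> 'rV[R]_p) x v :
  differentiable T x -> differentiable F (T x) ->
  'D_v (fun y => F (T y)) x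
  = \sum_j 'D_v (fun y => T y 0 j) x * 'D_('e_j) F (T x).
Proof.
move=> dT dF.
have dTF := differentiable_comp dT dF.
rewrite (@deriveE _ _ _ (F \o T)) // diff_comp //=.
rewrite -(deriveE v dT) derive_mx; last exact: diff_derivable.
rewrite [X in 'd F _ X]row_sum_delta linear_sum; apply: eq_bigr => j _ /=.
by rewrite mxE linearZ /= (deriveE _ dF).
Qed.

(** By induction on the order: the partial derivatives of [F \o T] are sums of
products of partial derivatives of [T] with composites [('D_('e_j) F) \o T]. *)
Lemma smooth_on_comp (U : set 'rV[R]_m) (V : set 'rV[R]_p)
    (F : 'rV[R]_p -> R) (T : 'rV[R]_m -> 'rV[R]_p) :
  open U -> (forall x, U x -> V (T x)) ->
  (forall j, smooth_on U (fun x => T x 0 j)) -> smooth_on V F ->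
  smooth_on U (fun x => F (T x)).
Proof.
move=> oU UV sT /smooth_onP sF; apply/smooth_onP => k.
have dT x : U x -> differentiable T x.
  move=> Ux; apply: differentiable_mx => i j; rewrite ord1.
  exact: smooth_on_diff (sT j) Ux.
elim: k F sF => [|k IH] F sF;
  (split; [move=> x Ux|move=> // i]).
- apply: (@differentiable_comp _ _ _ _ T F); first exact: dT.
  by apply: (sF 0%N).1; exact: UV.
- apply: (@differentiable_comp _ _ _ _ T F); first exact: dT.
  by apply: (sF 0%N).1; exact: UV.
have H : diff_upto k U
    (fun x => \sum_j 'D_('e_i) (fun y => T y 0 j) x * 'D_('e_j) F (T x)).
  have H j : diff_upto k U
      (fun x => 'D_('e_i) (fun y => T y 0 j) x * 'D_('e_j) F (T x)).
    apply: diff_uptoM => //.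
      by apply: (smooth_onP _ _).1; exact: smooth_on_partial.
    apply: (IH (fun y => 'D_('e_j) F y)) => l; exact: (sF l.+1).2.
  elim: (index_enum _) => [|j r IHr].
    by apply: diff_upto_eq (diff_upto_cst _ _ 0) => // x _; rewrite big_nil.
  by apply: diff_upto_eq (diff_uptoD _ (H j) IHr) => // x _; rewrite big_cons.
apply: diff_upto_eq H => // x /set_mem Ux; rewrite derive_comp_rV //; first exact: dT.
by apply: (sF 0%N).1; exact: UV.
Qed.

End smooth_maps.

(** * Symmetry of second derivatives *)

Section Schwarz.
Context {R : realType} {V : normedModType R}.

Lemma is_derive_line (F : V -> R) (y u : V) (t : R) :
  differentiable F (y + t *: u) ->
  is_derive t 1 (fun s => F (y + s *: u)) ('D_u F (y + t *: u)).
Proof.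
move=> dF; pose A (s : R) := y + s *: u.
have [dA dAE] : is_diff t A (fun s => s *: u).
  have D := @is_diffD _ _ _ (cst y) _ _ _ t (is_diff_cst y t) (is_diff_scalel t u).
  by apply: is_diff_eq D _; apply/funext => s; rewrite /= add0r.
have dFA : differentiable (F \o A) t.
  by apply: differentiable_comp.
apply: DeriveDef; first exact: (diff_derivable dFA).
rewrite (@deriveE _ _ _ (F \o A)) // diff_comp //=.
by rewrite dAE scale1r deriveE.
Qed.

Let second_difference (F : V -> R) x u v h :=
  F (x + h *: u + h *: v) - F (x + h *: u) - (F (x + h *: v) - F x).

(** The mean value theorem along [u] turns the second difference into [h] times
an increment of ['D_u F] between two points near [x] that differ by [h *: v];
the differential of ['D_u F] at [x] computes that increment up to a multiple of [e * h]. *)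
Lemma second_difference_approx (F : V -> R) x (u v : V) (e : R) :
  (\forall y \near x, differentiable F y) ->
  differentiable (fun y => 'D_u F y) x -> 0 < e ->
  \forall h \near 0^'+, `|second_difference F x u v h
      - h ^+ 2 * 'D_v (fun y => 'D_u F y) x| <= e * (2 * `|u| + `|v|) * h ^+ 2.
Proof.
move=> dF dDF e0; pose G := fun y => 'D_u F y; pose L := 'd G x.
have [d d0 near_d] : exists2 d : R, 0 < d & forall w : V, `|w| < d ->
    differentiable F (x + w) /\ `|G (x + w) - G x - L w| <= e * `|w|.
  have H1 : \forall w \near (0 : V), differentiable F (w + x).
    by move: dF; rewrite (near_shift 0 x) /=; apply: filterS => y; rewrite subr0.
  have H2 : \forall w \near (0 : V), `|G (w + x) - G x - L w| <= e * `|w|.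
    have /eqaddoP/(_ e e0) := diff_locally dDF.
    apply: filterS => w; rewrite !fctE /= /cst /shift /=.
    by rewrite opprD addrA.
  have [d /= d0 H] := (nbhs_ballP _ _).1 (filterI H1 H2).
  exists d => // w wd; have [] := H w.
    by rewrite -ball_normE /= sub0r normrN.
  by rewrite addrC.
have D0 : 0 < `|u| + `|v| + 1 by rewrite ltr_wpDl// addr_ge0.
near=> h.
have h0 : 0 < h by near: h; exact: nbhs_right_gt.
have hd : h * (`|u| + `|v| + 1) < d.
  rewrite -ltr_pdivlMr //; near: h; apply: nbhs_right_lt.
  exact: divr_gt0.
have small a b : 0 <= a <= h -> 0 <= b <= h -> `|a *: u + b *: v| < d.
  move=> /andP[a0 ah] /andP[b0 bh]; apply: le_lt_trans (ler_normD _ _) _.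
  rewrite !normrZ !ger0_norm //; apply: le_lt_trans hd.
  rewrite !mulrDr mulr1 ler_wpDr ?(ltW h0) //.
  by rewrite lerD // ler_wpM2r.
have h0h : 0 <= h <= h by rewrite lexx ltW.
pose phi (t : R) := F (x + h *: v + t *: u) - F (x + t *: u).
have dphi t : 0 <= t <= h ->
    is_derive t 1 phi (G (x + h *: v + t *: u) - G (x + t *: u)).
  move=> th; apply: is_deriveB.
    apply: is_derive_line; rewrite -addrA [h *: v + _]addrC.
    exact: (near_d _ (small _ _ th h0h)).1.
  apply: is_derive_line; have := near_d _ (small _ 0 th _).
  by rewrite lexx ltW // scale0r addr0 => /(_ isT) [].
have [||c cI] := @MVT _ phi (fun t => G (x + h *: v + t *: u) - G (x + t *: u)) _ _ h0.
- by move=> t /[!in_itv] /= /andP[t0 th]; apply: dphi; rewrite !ltW.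
- apply: derivable_within_continuous => t /[!in_itv] /= th.
  by have [] := dphi t th.
have {}cI : 0 <= c <= h by move: cI; rewrite in_itv /= => /andP[? ?]; rewrite !ltW.
have -> : phi h - phi 0 = second_difference F x u v h.
  rewrite /phi /second_difference !scale0r !addr0.
  by rewrite [x + h *: v + _]addrAC.
rewrite subr0 => ->.
have [_ E1] := near_d _ (small _ _ cI h0h).
have [_] := near_d _ (small _ 0 cI (introT andP (conj (lexx 0) (ltW h0)))).
rewrite scale0r addr0 => E2.
rewrite (deriveE _ dDF) -/G -/L.
have -> : x + h *: v + c *: u = x + (c *: u + h *: v) by rewrite -addrA [h *: v + _]addrC.
have Lcv : L (c *: u + h *: v) = L (c *: u) + h * L v.
  by rewrite linearD [in X in _ + X]linearZ.
set p := G _ - G x - _ in E1; set q := G _ - G x - _ in E2.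
have -> : (G (x + (c *: u + h *: v)) - G (x + c *: u)) * h - h ^+ 2 * L v
    = (p - q) * h.
  by rewrite /p /q Lcv; ring.
rewrite normrM (ger0_norm (ltW h0)) expr2 mulrA ler_wpM2r ?(ltW h0) //.
apply: le_trans (ler_normB _ _) _; apply: le_trans (lerD E1 E2) _.
rewrite -mulrDr -mulrA ler_wpM2l ?(ltW e0)//.
have /andP[c0 ch] := cI.
have H1 : `|c *: u + h *: v| <= h * `|u| + h * `|v|.
  apply: le_trans (ler_normD _ _) _.
  by rewrite !normrZ !ger0_norm ?(ltW h0)// lerD // ler_wpM2r.
have H2 : `|c *: u| <= h * `|u| by rewrite normrZ ger0_norm // ler_wpM2r.
by apply: le_trans (lerD H1 H2) _; rewrite le_eqVlt; apply/orP; left; apply/eqP; ring.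
Unshelve. all: by end_near. Qed.

(** The second difference is symmetric in [u] and [v], so both mixed derivatives
are its limit after division by [h ^+ 2]. *)
Lemma derive_comm (F : V -> R) x (u v : V) :
  (\forall y \near x, differentiable F y) ->
  differentiable (fun y => 'D_u F y) x -> differentiable (fun y => 'D_v F y) x ->
  'D_v (fun y => 'D_u F y) x = 'D_u (fun y => 'D_v F y) x.
Proof.
move=> dF dFu dFv; apply/eqP; rewrite -subr_eq0 -normr_le0.
apply/ler_addgt0Pl => e e0; rewrite addr0.
(* the two error terms of the second differences add up to 3 (|u| + |v|);
   adding 1 keeps the divisor positive when u = v = 0 *)
pose K := 3 * (`|u| + `|v|) + 1.
have K0 : 0 < K by rewrite ltr_wpDl// mulr_ge0// addr_ge0.
have eK0 : 0 < e / K by exact: divr_gt0.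
near (0 : R)^'+ => h.
have h0 : 0 < h by near: h; exact: nbhs_right_gt.
have A1 : `|second_difference F x u v h - h ^+ 2 * 'D_v (fun y => 'D_u F y) x|
    <= e / K * (2 * `|u| + `|v|) * h ^+ 2.
  by near: h; exact: second_difference_approx.
have A2 : `|second_difference F x v u h - h ^+ 2 * 'D_u (fun y => 'D_v F y) x|
    <= e / K * (2 * `|v| + `|u|) * h ^+ 2.
  by near: h; exact: second_difference_approx.
have A3 : second_difference F x v u h = second_difference F x u v h.
  rewrite /second_difference [x + h *: v + _]addrAC; ring.
rewrite A3 in A2; move: A1 A2; set a := 'D_v _ x; set b := 'D_u _ x.
set s := second_difference _ _ _ _ _ => A1 A2.
have h20 : 0 < h ^+ 2 by rewrite exprn_gt0.
rewrite -(ler_pM2l h20) -[X in X * `|_|](gtr0_norm h20) -normrM.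
have -> : h ^+ 2 * (a - b) = (s - h ^+ 2 * b) - (s - h ^+ 2 * a) by ring.
apply: le_trans (ler_normB _ _) _; apply: le_trans (lerD A2 A1) _.
have -> : e / K * (2 * `|v| + `|u|) * h ^+ 2 + e / K * (2 * `|u| + `|v|) * h ^+ 2
   = h ^+ 2 * (e * ((K - 1) / K)) by rewrite /K; ring.
rewrite ler_pM2l // -[leRHS]mulr1 ler_pM2l // ler_pdivrMr // mul1r.
by rewrite gerBl.
Unshelve. all: by end_near. Qed.
End Schwarz.

Lemma smooth_on_derive_comm (R : realType) m (U : set 'rV[R]_m) F x (i j : 'I_m) :
  open U -> smooth_on U F -> U x ->
  'D_('e_i) (fun y => 'D_('e_j) F y) x = 'D_('e_j) (fun y => 'D_('e_i) F y) x.
Proof.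
move=> oU sF Ux; apply: derive_comm.
- apply: filterS (open_nbhs_nbhs (conj oU Ux)) => y Uy; exact: (sF [::]).
- exact: (sF [:: j]).
- exact: (sF [:: i]).
Qed.

(** * Calculus of matrix-valued functions *)

Lemma eq_derive (R : realType) (V W : normedModType R) (f h : V -> W) x v :
  f =1 h -> 'D_v f x = 'D_v h x.
Proof. by move/funext ->. Qed.

Lemma derive_mul (R : realType) (V : normedModType R) (F H : V -> R) x v :
  differentiable F x -> differentiable H x ->
  'D_v (fun y => F y * H y) x = 'D_v F x * H x + F x * 'D_v H x.
Proof.
move=> dF dH; rewrite (@deriveM _ _ F H); [|exact: diff_derivable..].
by rewrite addrC; congr (_ + _); exact: mulrC.
Qed.

Lemma derive_bigsum (R : realType) (V : normedModType R) n (F : 'I_n -> V -> R) x v :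
  (forall j, differentiable (F j) x) ->
  'D_v (fun y => \sum_j F j y) x = \sum_j 'D_v (F j) x.
Proof.
move=> dF; rewrite -derive_sum; last by move=> j; exact: diff_derivable.
by apply: eq_derive => y; rewrite fct_sumE.
Qed.

(** Locked, so that comparing two entries of derivatives does not unfold them
into limits. *)
HB.lock Definition dmx (R : realType) (m p q : nat) (i : 'I_m)
    (A : 'rV[R]_m -> 'M[R]_(p, q)) (x : 'rV[R]_m) : 'M[R]_(p, q) :=
  \matrix_(a, b) 'D_('e_i) (fun y => A y a b) x.

Lemma dmxE (R : realType) (m p q : nat) (i : 'I_m)
    (A : 'rV[R]_m -> 'M[R]_(p, q)) (x : 'rV[R]_m) a b :
  dmx i A x a b = 'D_('e_i) (fun y => A y a b) x.
Proof. by rewrite dmx.unlock mxE. Qed.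

Section matrix_calculus.
Context {R : realType} {m : nat}.
Variable (U : set 'rV[R]_m).
Hypothesis oU : open U.

Definition smooth_mx p q (A : 'rV[R]_m -> 'M[R]_(p, q)) : Prop :=
  forall a b, smooth_on U (fun x => A x a b).

Lemma smooth_mx_diff p q (A : 'rV[R]_m -> 'M[R]_(p, q)) x a b :
  smooth_mx A -> U x -> differentiable (fun y => A y a b) x.
Proof. by move=> sA Ux; exact: smooth_on_diff (sA a b) Ux. Qed.

Lemma smooth_mx_derivable p q (A : 'rV[R]_m -> 'M[R]_(p, q)) x v a b :
  smooth_mx A -> U x -> derivable (fun y => A y a b) x v.
Proof. by move=> sA Ux; apply: diff_derivable; exact: smooth_mx_diff. Qed.

Lemma smooth_mx_dmx p q i (A : 'rV[R]_m -> 'M[R]_(p, q)) :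
  smooth_mx A -> smooth_mx (dmx i A).
Proof.
move=> sA a b; apply: smooth_on_eq (smooth_on_partial i (sA a b)) => // x _.
by rewrite dmxE.
Qed.

Lemma smooth_mxD p q (A B : 'rV[R]_m -> 'M[R]_(p, q)) :
  smooth_mx A -> smooth_mx B -> smooth_mx (fun x => A x + B x).
Proof.
move=> sA sB a b; apply: smooth_on_eq (smooth_onD oU (sA a b) (sB a b)) => // x _.
by rewrite mxE.
Qed.

Lemma smooth_mxN p q (A : 'rV[R]_m -> 'M[R]_(p, q)) :
  smooth_mx A -> smooth_mx (fun x => - A x).
Proof.
by move=> sA a b; apply: smooth_on_eq (smooth_onN oU (sA a b)) => // x _; rewrite mxE.
Qed.

Lemma smooth_mxM p q s (A : 'rV[R]_m -> 'M[R]_(p, q)) (B : 'rV[R]_m -> 'M[R]_(q, s)) :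
  smooth_mx A -> smooth_mx B -> smooth_mx (fun x => A x *m B x).
Proof.
move=> sA sB a b; have H : smooth_on U (fun x => \sum_j A x a j * B x j b).
  by apply: smooth_on_sum => // j _; exact: smooth_onM.
by apply: smooth_on_eq H => // x _; rewrite mxE.
Qed.

Lemma smooth_mxT p q (A : 'rV[R]_m -> 'M[R]_(p, q)) :
  smooth_mx A -> smooth_mx (fun x => (A x)^T).
Proof. by move=> sA a b; apply: smooth_on_eq (sA b a) => // x _; rewrite mxE. Qed.

Lemma smooth_mxZ p q (f : 'rV[R]_m -> R) (A : 'rV[R]_m -> 'M[R]_(p, q)) :
  smooth_on U f -> smooth_mx A -> smooth_mx (fun x => f x *: A x).
Proof.
move=> sf sA a b; apply: smooth_on_eq (smooth_onM oU sf (sA a b)) => // x _.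
by rewrite mxE.
Qed.

Lemma smooth_mx_sum p q (I : Type) (r : seq I) (A : I -> 'rV[R]_m -> 'M[R]_(p, q)) :
  (forall i, smooth_mx (A i)) -> smooth_mx (fun x => \sum_(i <- r) A i x).
Proof.
move=> sA a b.
apply: smooth_on_eq (smooth_on_sum oU r (P := xpredT) (fun i _ => sA i a b)) => // x _.
by rewrite summxE.
Qed.

Lemma smooth_det p (A : 'rV[R]_m -> 'M[R]_p) :
  smooth_mx A -> smooth_on U (fun x => \det (A x)).
Proof.
move=> sA; apply: smooth_on_sum => // s _; apply: smooth_onM => //.
  exact: smooth_on_cst.
by apply: smooth_on_prod => // i _; exact: sA.
Qed.

(** Cramer's rule: the entries are cofactors divided by the determinant. *)
Lemma smooth_invmx p (A : 'rV[R]_m -> 'M[R]_p) :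
  (forall x, U x -> A x \in unitmx) ->
  smooth_mx A -> smooth_mx (fun x => invmx (A x)).
Proof.
move=> uA sA a b.
have H : smooth_on U (fun x => (\det (A x))^-1 * cofactor (A x) b a).
  apply: smooth_onM => //.
    apply: smooth_onV => //; last exact: smooth_det.
    by move=> x /set_mem /uA; rewrite unitmxE unitfE.
  apply: smooth_onM => //; first exact: smooth_on_cst.
  apply: smooth_det => i j.
  by apply: smooth_on_eq (sA (lift b i) (lift a j)) => // x _; rewrite !mxE.
apply: smooth_on_eq H => // x /set_mem Ux.
by rewrite /invmx uA // !mxE.
Qed.

Lemma dmx_eq p q i (A B : 'rV[R]_m -> 'M[R]_(p, q)) x :
  (forall y, U y -> A y = B y) -> U x -> dmx i A x = dmx i B x.
Proof.
move=> AB Ux; apply/matrixP => a b; rewrite !dmxE; apply: near_eq_derive.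
by apply: filterS (open_nbhs_nbhs (conj oU Ux)) => y Uy; rewrite AB.
Qed.

Lemma dmxT p q i (A : 'rV[R]_m -> 'M[R]_(p, q)) x :
  dmx i (fun y => (A y)^T) x = (dmx i A x)^T.
Proof.
apply/matrixP => a b; rewrite [RHS]mxE !dmxE; apply: eq_derive => y.
by rewrite mxE.
Qed.

Lemma dmxD p q i (A B : 'rV[R]_m -> 'M[R]_(p, q)) x :
  smooth_mx A -> smooth_mx B -> U x ->
  dmx i (fun y => A y + B y) x = dmx i A x + dmx i B x.
Proof.
move=> sA sB Ux; apply/matrixP => a b; rewrite mxE !dmxE.
rewrite -(@deriveD _ _ _ (fun y => A y a b) (fun y => B y a b));
  try exact: smooth_mx_derivable.
by apply: eq_derive => y; rewrite mxE.
Qed.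

Lemma dmx_sum p q i (I : finType) (A : I -> 'rV[R]_m -> 'M[R]_(p, q)) x :
  (forall k, smooth_mx (A k)) -> U x ->
  dmx i (fun y => \sum_k A k y) x = \sum_k dmx i (A k) x.
Proof.
move=> sA Ux; elim: (index_enum I) => [|k r IH].
  rewrite big_nil; apply/matrixP => a b; rewrite dmxE mxE.
  have -> : (fun y => (\sum_(k <- [::]) A k y) a b) = cst 0.
    by apply/funext => y; rewrite big_nil mxE.
  exact: derive_cst.
rewrite big_cons -IH -dmxD //; last exact: smooth_mx_sum.
by apply: dmx_eq => // y _; rewrite big_cons.
Qed.

Lemma dmxZ p q i (f : 'rV[R]_m -> R) (A : 'rV[R]_m -> 'M[R]_(p, q)) x :
  smooth_on U f -> smooth_mx A -> U x ->
  dmx i (fun y => f y *: A y) x = 'D_('e_i) f x *: A x + f x *: dmx i A x.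
Proof.
move=> sf sA Ux; apply/matrixP => a b; rewrite 3!mxE !dmxE.
rewrite -derive_mul; [|exact: smooth_on_diff Ux|exact: smooth_mx_diff].
by apply: eq_derive => y; rewrite mxE.
Qed.

Lemma dmxM p q s i (A : 'rV[R]_m -> 'M[R]_(p, q)) (B : 'rV[R]_m -> 'M[R]_(q, s)) x :
  smooth_mx A -> smooth_mx B -> U x ->
  dmx i (fun y => A y *m B y) x = dmx i A x *m B x + A x *m dmx i B x.
Proof.
move=> sA sB Ux; apply/matrixP => a b; rewrite 3!mxE !dmxE.
rewrite -big_split /=.
transitivity (\sum_j 'D_('e_i) (fun y => A y a j * B y j b) x).
  rewrite -derive_bigsum; first by apply: eq_derive => y; rewrite mxE.
  by move=> j; apply: differentiableM; exact: smooth_mx_diff.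
by apply: eq_bigr => j _; rewrite derive_mul ?dmxE//; exact: smooth_mx_diff.
Qed.

Lemma dmx_comm p q i j (A : 'rV[R]_m -> 'M[R]_(p, q)) x :
  smooth_mx A -> U x -> dmx i (dmx j A) x = dmx j (dmx i A) x.
Proof.
move=> sA Ux; have E k l a b : dmx k (dmx l A) x a b
    = 'D_('e_k) (fun y => 'D_('e_l) (fun z => A z a b) y) x.
  apply: etrans (dmxE k (dmx l A) x a b) _.
  by apply: eq_derive => y; exact: dmxE.
apply/matrixP => a b; apply: etrans (E i j a b) _.
apply: etrans _ (esym (E j i a b)).
exact: smooth_on_derive_comm oU (sA a b) Ux.
Qed.

End matrix_calculus.

(** * Connection and curvature on an open set of coordinates *)

Section local_geometry.
Context {R : realType} {m : nat}.
Variables (U : set 'rV[R]_m) (G : 'rV[R]_m -> 'M[R]_m).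
Hypotheses (oU : open U) (sG : smooth_mx U G).
Hypotheses (symG : forall x, U x -> (G x)^T = G x).
Hypotheses (unitG : forall x, U x -> G x \in unitmx).

(** Christoffel symbols of the first kind, with the derivation index [i] kept
apart: they form one matrix for each coordinate direction. *)
Definition christoffel1 (i : 'I_m) (x : 'rV[R]_m) : 'M[R]_m :=
  \matrix_(j, l) (2^-1 * (dmx i G x j l + dmx j G x i l - dmx l G x i j)).

(** Entry [j, k] is the Christoffel symbol with upper index [k] and lower indices
[i], [j], so that the matrix acts from the right on rows of components. *)
Definition conn_mx (i : 'I_m) (x : 'rV[R]_m) : 'M[R]_m :=
  christoffel1 i x *m (invmx (G x))^T.

(** The products come in the opposite order to the usual formula because the
matrices act on rows from the right. *)
Definition curv_mx (i j : 'I_m) (x : 'rV[R]_m) : 'M[R]_m :=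
  dmx i (conn_mx j) x - dmx j (conn_mx i) x
  + conn_mx j x *m conn_mx i x - conn_mx i x *m conn_mx j x.

Definition cov_deriv (X Y : 'rV[R]_m -> 'rV[R]_m) (x : 'rV[R]_m) : 'rV[R]_m :=
  \sum_i X x 0 i *: (dmx i Y x + Y x *m conn_mx i x).

Definition lie_bracket (X Y : 'rV[R]_m -> 'rV[R]_m) (x : 'rV[R]_m) : 'rV[R]_m :=
  \sum_i (X x 0 i *: dmx i Y x - Y x 0 i *: dmx i X x).

Lemma christoffel1E i x j l : christoffel1 i x j l =
  2^-1 * (dmx i G x j l + dmx j G x i l - dmx l G x i j).
Proof. by rewrite /christoffel1 mxE. Qed.

Lemma smooth_conn_mx i : smooth_mx U (conn_mx i).
Proof.
apply: smooth_mxM => //; last by apply: smooth_mxT => //; exact: smooth_invmx.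
move=> j l; have dG a b c := smooth_mx_dmx oU c sG a b.
have H : smooth_on U (fun x => 2^-1 * (dmx i G x j l + dmx j G x i l - dmx l G x i j)).
  apply: smooth_onM; [by []|exact: smooth_on_cst|].
  by apply: smooth_onB => //; exact: smooth_onD.
by apply: smooth_on_eq H => // x _; exact: esym (christoffel1E i x j l).
Qed.

Lemma smooth_curv_mx i j : smooth_mx U (curv_mx i j).
Proof.
have sC := smooth_conn_mx.
have sM k l := smooth_mxM oU (sC k) (sC l).
have sD k l := smooth_mx_dmx oU k (sC l).
have H := smooth_mxD oU (smooth_mxD oU (smooth_mxD oU (sD i j)
  (smooth_mxN oU (sD j i))) (sM j i)) (smooth_mxN oU (sM i j)).
exact: H.
Qed.

Lemma dmx_metric_sym i x a b : U x -> dmx i G x a b = dmx i G x b a.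
Proof.
move=> Ux; rewrite -[in RHS](dmx_eq oU i symG Ux) dmxT.
by rewrite [RHS]mxE.
Qed.

(** The Levi-Civita connection has no torsion. *)
Lemma conn_mx_sym i j k x : U x -> conn_mx i x j k = conn_mx j x i k.
Proof.
move=> Ux; rewrite /conn_mx [LHS]mxE [RHS]mxE; apply: eq_bigr => l _.
congr (_ * _); rewrite !christoffel1E (dmx_metric_sym l j i Ux).
by rewrite [dmx i G x j l + _]addrC.
Qed.

(** The Levi-Civita connection preserves the metric. *)
Lemma conn_mx_metric i x : U x ->
  dmx i G x = conn_mx i x *m G x + (conn_mx i x *m G x)^T.
Proof.
move=> Ux; have -> : conn_mx i x *m G x = christoffel1 i x.
  by rewrite -mulmxA -[X in _ *m X]trmxK trmx_mul trmxK symG // mulmxV ?unitG // trmx1 mulmx1.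
apply/matrixP => j l; rewrite [RHS]mxE [in X in _ = _ + X]mxE !christoffel1E.
rewrite (dmx_metric_sym i l j Ux) (dmx_metric_sym l i j Ux).
by rewrite (dmx_metric_sym j i l Ux); field.
Qed.

Lemma curv_mx_anti i j x : curv_mx j i x = - curv_mx i j x.
Proof. by apply/matrixP => a b; rewrite !mxE; ring. Qed.

(** Differentiating the compatibility of the connection with the metric once
more and antisymmetrising, the second derivatives of the metric cancel and the
symmetric part of the curvature remains. *)
Lemma curv_mx_skew i j x : U x ->
  (curv_mx i j x *m G x)^T = - (curv_mx i j x *m G x).
Proof.
move=> Ux; have sC := smooth_conn_mx.
have D2 a b : dmx a (dmx b G) x
    = (dmx a (conn_mx b) x + conn_mx b x *m conn_mx a x) *m G x
      + ((dmx a (conn_mx b) x + conn_mx b x *m conn_mx a x) *m G x)^T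
      + (conn_mx b x *m G x *m (conn_mx a x)^T
         + conn_mx a x *m G x *m (conn_mx b x)^T).
  rewrite (dmx_eq oU a (conn_mx_metric b) Ux) (dmxD (U := U)) //; last 2 first.
  - exact: smooth_mxM.
  - by apply: smooth_mxT => //; exact: smooth_mxM.
  rewrite dmxT (dmxM (U := U)) // conn_mx_metric //.
  rewrite !(trmx_mul, linearD, mulmxDr, mulmxDl) /= ?symG // !mulmxA.
  rewrite !(trmx_mul, trmxK) ?symG // !mulmxA.
  by apply/matrixP => k l; rewrite !(mxE _ _ k l); ring.
have := dmx_comm oU i j sG Ux.
rewrite !D2.
have -> : curv_mx i j x *m G x
  = (dmx i (conn_mx j) x + conn_mx j x *m conn_mx i x) *m G x
    - (dmx j (conn_mx i) x + conn_mx i x *m conn_mx j x) *m G x.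
  rewrite -mulmxBl; congr (_ *m _).
  by apply/matrixP => a b; rewrite /curv_mx !(mxE _ _ a b); ring.
set P := _ *m G x; set Q := _ *m G x.
set S1 := conn_mx j x *m _ *m _; set S2 := conn_mx i x *m _ *m _.
move=> /matrixP E; apply/matrixP => a b; move: (E a b); rewrite !mxE => Eab.
lra.
Qed.

(** Both the derivative term and the quadratic term of the curvature are
antisymmetrised in [i, j] and symmetric in [j, k] by absence of torsion, so that
their cyclic sum vanishes. *)
Lemma curv_mx_bianchi i j k l x : U x ->
  curv_mx i j x k l + curv_mx j k x i l + curv_mx k i x j l = 0.
Proof.
move=> Ux; pose a i j k := dmx i (conn_mx j) x k l.
pose b i j k := (conn_mx j x *m conn_mx i x) k l.
have sa p q s : a p q s = a p s q.
  rewrite /a !dmxE; apply: near_eq_derive.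
  apply: filterS (open_nbhs_nbhs (conj oU Ux)) => y Uy.
  exact: conn_mx_sym.
have sb p q s : b p q s = b p s q.
  by rewrite /b !mxE; apply: eq_bigr => t _; rewrite (conn_mx_sym _ _ _ Ux).
have E p q s : curv_mx p q x s l = a p q s - a q p s + b p q s - b q p s.
  by rewrite /curv_mx /a /b !(mxE _ _ s l).
rewrite !E (sa j k) (sa i k) (sa k j) (sb j k) (sb i k) (sb k j).
ring.
Qed.

(** Commuting second covariant derivatives leaves a tensor: the second
derivatives of [Z] cancel by symmetry and the terms where [X] or [Y] is
differentiated are those of the bracket. *)
Lemma cov_commutator X Y Z x :
  smooth_mx U X -> smooth_mx U Y -> smooth_mx U Z -> U x ->
  cov_deriv X (cov_deriv Y Z) x - cov_deriv Y (cov_deriv X Z) x - cov_deriv (lie_bracket X Y) Z x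
  = \sum_i \sum_j (X x 0 i * Y x 0 j) *: (Z x *m curv_mx i j x).
Proof.
move=> sX sY sZ Ux; have sC := smooth_conn_mx.
pose N j y := dmx j Z y + Z y *m conn_mx j y.
have sN j : smooth_mx U (N j).
  by apply: smooth_mxD => //; [exact: smooth_mx_dmx|exact: smooth_mxM].
pose P i j := dmx i (N j) x + N j x *m conn_mx i x.
(* the terms of P i j that contain derivatives of Z are symmetric in i, j *)
have PB i j : P i j - P j i = Z x *m curv_mx i j x.
  have E p q : P p q = dmx p (dmx q Z) x + dmx p Z x *m conn_mx q x
      + dmx q Z x *m conn_mx p x
      + Z x *m (dmx p (conn_mx q) x + conn_mx q x *m conn_mx p x).
    rewrite /P /N (dmxD (U := U)) //; [|exact: smooth_mx_dmx|exact: smooth_mxM].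
    rewrite (dmxM (U := U)) // mulmxDl mulmxDr !addrA mulmxA.
    by congr (_ + _); exact: addrAC.
  rewrite !E (dmx_comm oU j i sZ Ux) /curv_mx.
  have -> : Z x *m (dmx i (conn_mx j) x - dmx j (conn_mx i) x
      + conn_mx j x *m conn_mx i x - conn_mx i x *m conn_mx j x)
    = Z x *m (dmx i (conn_mx j) x + conn_mx j x *m conn_mx i x)
      - Z x *m (dmx j (conn_mx i) x + conn_mx i x *m conn_mx j x).
    rewrite -mulmxBr; congr (_ *m _).
    by apply/matrixP => a b; rewrite !(mxE _ _ a b); ring.
  by apply/matrixP => a b; rewrite !(mxE _ _ a b); ring.
have E (X1 Y1 : 'rV[R]_m -> 'rV[R]_m) : smooth_mx U Y1 -> cov_deriv X1 (cov_deriv Y1 Z) x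
    = \sum_i \sum_j ((X1 x 0 i * dmx i Y1 x 0 j) *: N j x
                     + (X1 x 0 i * Y1 x 0 j) *: P i j).
  move=> sY1; apply: eq_bigr => i _.
  have -> : dmx i (cov_deriv Y1 Z) x
      = \sum_j (dmx i Y1 x 0 j *: N j x + Y1 x 0 j *: dmx i (N j) x).
    have sYN j := smooth_mxZ oU (sY1 0 j) (sN j).
    apply: etrans (dmx_sum oU i sYN Ux) _.
    by apply: eq_bigr => j _; rewrite (dmxZ i (sY1 0 j) (sN j) Ux) dmxE.
  rewrite /cov_deriv -/N mulmx_suml -big_split scaler_sumr; apply: eq_bigr => j _ /=.
  by rewrite -scalemxAl -addrA -scalerDr [LHS]scalerDr !scalerA.
rewrite !E //.
have -> : cov_deriv (lie_bracket X Y) Z x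
    = \sum_i \sum_j ((X x 0 i * dmx i Y x 0 j) *: N j x)
      - \sum_i \sum_j ((Y x 0 i * dmx i X x 0 j) *: N j x).
  rewrite exchange_big [in X in _ - X]exchange_big -sumrB; apply: eq_bigr => j _ /=.
  rewrite -sumrB /lie_bracket summxE -/(N j x) scaler_suml; apply: eq_bigr => i _.
  by rewrite -scalerBl !(mxE _ _ 0 j).
have S (X1 Y1 : 'rV[R]_m -> 'rV[R]_m) :
   \sum_i \sum_j ((X1 x 0 i * dmx i Y1 x 0 j) *: N j x
                     + (X1 x 0 i * Y1 x 0 j) *: P i j)
   = \sum_i \sum_j ((X1 x 0 i * dmx i Y1 x 0 j) *: N j x)
     + \sum_i \sum_j (X1 x 0 i * Y1 x 0 j) *: P i j.
  by rewrite -big_split; apply: eq_bigr => i _; rewrite -big_split.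
rewrite !S.
have -> : \sum_i \sum_j (X x 0 i * Y x 0 j) *: (Z x *m curv_mx i j x)
  = \sum_i \sum_j (X x 0 i * Y x 0 j) *: P i j
    - \sum_i \sum_j (Y x 0 i * X x 0 j) *: P i j.
  rewrite [in X in _ - X]exchange_big -sumrB; apply: eq_bigr => i _ /=.
  rewrite -sumrB; apply: eq_bigr => j _.
  by rewrite [Y x 0 j * _]mulrC -scalerBr PB.
move: (\sum_i _) (\sum_i _) (\sum_i _) (\sum_i _) => v1 v2 v3 v4.
by apply/matrixP => a b; rewrite !mxE; ring.
Qed.

End local_geometry.

(** * Bump functions *)

Section flat_functions.
Context {R : realType}.

(** For [k = 0] this is the classical smooth function that vanishes to infinite
order at [0]; the powers of the inverse appear in its derivatives. *)
Definition flat_exp (k : nat) (s : R) : R :=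
  if 0 < s then s^-1 ^+ k * expR (- s^-1) else 0.

(** With [t = s^-1], the bound [t ^+ k.+2 / k.+2`! <= expR t] absorbs the power
of [t] and leaves the two factors [s] that give a zero derivative at [0]. *)
Lemma flat_le k (s : R) : `|flat_exp k s| <= (k.+2)`!%:R * s ^+ 2.
Proof.
rewrite /flat_exp; case: ifPn => [s0|_]; last by rewrite normr0 mulr_ge0 // sqr_ge0.
have t0 : 0 < s^-1 by rewrite invr_gt0.
have f0 : 0 < (k.+2)`!%:R :> R by rewrite ltr0n fact_gt0.
rewrite ger0_norm; last by rewrite mulr_ge0 ?exprn_ge0 ?expR_ge0 // ltW.
rewrite expRN ler_pdivrMr ?expR_gt0 //.
have E := expR_ge1Dxn k.+1 (ltW t0).
have {}E : s^-1 ^+ k.+2 / (k.+2)`!%:R <= expR s^-1.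
  by apply: le_trans E; rewrite lerDr.
have -> : s^-1 ^+ k = (k.+2)`!%:R * s ^+ 2 * (s^-1 ^+ k.+2 / (k.+2)`!%:R).
  rewrite -[k.+2]addn2 exprD [s^-1 ^+ 2]exprVn addn2; field.
  by rewrite !gt_eqF.
by rewrite ler_wpM2l // mulr_ge0 ?sqr_ge0 // ltW.
Qed.

(** The derivative of a flat function is a combination of flat functions, which
is what makes all of them smooth. *)
Lemma is_derive_flat k (s : R) :
  is_derive s 1 (flat_exp k) (flat_exp k.+2 s - k%:R * flat_exp k.+1 s).
Proof.
have [s0|s0|<-] := ltgtP 0 s.
- have H : \forall t \near s, (t^-1) ^+ k * expR (- t^-1) = flat_exp k t.
    near=> t; rewrite /flat_exp ifT //; near: t; exact: lt_nbhsr.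
  apply: near_eq_is_derive H _.
  have sn0 : s != 0 by rewrite gt_eqF.
  have dV : is_derive s 1 (fun t : R => t^-1) (- s ^- 2).
    apply: DeriveDef; first exact: (@derivableV _ _ id).
    by rewrite (@deriveV _ _ id) // derive_id [_ *: _]mulr1.
  have dX := @is_deriveX _ _ _ k _ _ _ dV.
  have dE := is_derive1_comp (is_derive_expR _) (is_deriveN dV).
  have dM := is_deriveM dX dE.
  rewrite (_ : (fun t : R => _) =
    (fun t : R => t^-1) ^+ k * (expR \o - (fun t : R => t^-1))); last first.
    by apply/funext => t; rewrite [RHS]/= exprfctE.
  apply: is_derive_eq dM _.
  rewrite /flat_exp s0 /= /GRing.scale /= opprK !exprfctE.
  set E := expR _; rewrite !exprVn.
  case: k {dX} => [|k]; first by field.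
  by rewrite -pred_Sn !exprS; field; rewrite sn0 expf_neq0.
- have H : \forall t \near s, cst (0 : R) t = flat_exp k t.
    near=> t; rewrite /flat_exp ifF //; apply/negbTE; rewrite -leNgt ltW //.
    by near: t; exact: lt_nbhsl.
  apply: near_eq_is_derive H _.
  rewrite /flat_exp ltNge (ltW s0) /= mulr0 subr0.
  exact: is_derive_cst.
rewrite /flat_exp ltxx mulr0 subr0.
have C : (fun h : R => h^-1 *: ((flat_exp k \o shift 0) (h *: 1) - flat_exp k 0)) @ 0^' --> (0 : R).
  apply/cvgrPdist_le => e e0; near=> h.
  have h0 : h != 0 by near: h; exact: nbhs_dnbhs_neq.
  rewrite sub0r normrN normrZ /= /shift /= addr0 [h *: 1]mulr1.
  rewrite [X in _ - X](_ : _ = 0) ?subr0; last by rewrite /flat_exp ltxx.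
  rewrite normfV ler_pdivrMl ?normr_gt0 //.
  apply: le_trans (flat_le k h) _; rewrite -real_normK ?num_real // expr2 mulrA.
  rewrite [leRHS]mulrC ler_wpM2r //.
  rewrite -ler_pdivlMl ?ltr0n ?fact_gt0 //.
  near: h; apply: dnbhs0_le => //.
  by rewrite mulr_gt0 // invr_gt0 ltr0n fact_gt0.
by apply: DeriveDef; [apply/cvg_ex; exists 0|apply: cvg_lim].
Unshelve. all: by end_near. Qed.

Lemma derive_flat_comp (V : normedModType R) k (s : V -> R) x v :
  differentiable s x ->
  'D_v (fun y => flat_exp k (s y)) x
  = (flat_exp k.+2 (s x) - k%:R * flat_exp k.+1 (s x)) * 'D_v s x.
Proof.
move=> ds; have [fd fE] := is_derive_flat k (s x).
have df : differentiable (flat_exp k) (s x) by apply/derivable1_diffP.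
have dfs := differentiable_comp ds df.
rewrite (@deriveE _ _ _ (flat_exp k \o s)) // diff_comp //= -(deriveE v ds).
set w : R := 'D_v s x.
have w1 : w = w *: (1 : R) by rewrite [RHS]mulr1.
by rewrite [in LHS]w1 linearZ /= -(deriveE _ df) fE; exact: mulrC.
Qed.

Lemma smooth_on_flat m (U : set 'rV[R]_m) k (s : 'rV[R]_m -> R) :
  open U -> smooth_on U s -> smooth_on U (fun x => flat_exp k (s x)).
Proof.
move=> oU ss; apply/smooth_onP => N.
have ds x : U x -> differentiable s x by exact: smooth_on_diff.
elim: N k => [|N IH] k; (split; [move=> x Ux|move=> // i]).
- apply: (@differentiable_comp _ _ _ _ s (flat_exp k)); first exact: ds.
  by apply/derivable1_diffP; have [] := is_derive_flat k (s x).
- apply: (@differentiable_comp _ _ _ _ s (flat_exp k)); first exact: ds.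
  by apply/derivable1_diffP; have [] := is_derive_flat k (s x).
have H : diff_upto N U
   (fun x => (flat_exp k.+2 (s x) + (- k%:R) * flat_exp k.+1 (s x)) * 'D_('e_i) s x).
  apply: diff_uptoM => //; last first.
    by apply: (smooth_onP _ _).1; exact: smooth_on_partial.
  apply: (diff_uptoD oU (IH _)).
  exact: (diff_uptoM oU (diff_upto_cst _ _ _) (IH _)).
apply: diff_upto_eq H => // x /set_mem Ux.
by rewrite derive_flat_comp ?mulNr//; exact: ds.
Qed.

End flat_functions.

Lemma derive_coord (R : realType) m (x v : 'rV[R]_m) j :
  'D_v (fun y : 'rV[R]_m => y 0 j) x = v 0 j.
Proof.
have dI : derivable (@id 'rV[R]_m) x v by exact: derivable_id.
have := derive_mx dI; rewrite derive_id => /matrixP/(_ 0 j) E.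
by apply: esym; apply: etrans E _; rewrite [LHS]mxE.
Qed.

Lemma smooth_on_coord (R : realType) m (U : set 'rV[R]_m) j :
  open U -> smooth_on U (fun x : 'rV[R]_m => x 0 j).
Proof.
move=> oU; apply/smooth_onP => -[|k]; first by split=> // x _; exact: differentiable_coord.
split=> [x _|i]; first exact: differentiable_coord.
have H : diff_upto k U (fun=> ('e_i : 'rV[R]_m) 0 j) by exact: diff_upto_cst.
apply: diff_upto_eq H => // x _.
exact: esym (derive_coord _ _ _).
Qed.

(** A product of flat functions of the coordinates, positive exactly on the
open box of radius [e] around [a]. *)
Definition bump (R : realType) m (a : 'rV[R]_m) (e : R) (x : 'rV[R]_m) : R :=
  \prod_j flat_exp 0 (e ^+ 2 - (x 0 j - a 0 j) ^+ 2).

Lemma smooth_bump (R : realType) m (a : 'rV[R]_m) (e : R) (U : set 'rV[R]_m) :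
  open U -> smooth_on U (bump a e).
Proof.
move=> oU; apply: smooth_on_prod => // j _; apply: smooth_on_flat => //.
have sc c : smooth_on U (fun=> c : R) by exact: smooth_on_cst.
have sx : smooth_on U (fun x => x 0 j - a 0 j).
  by apply: smooth_onB => //; exact: smooth_on_coord.
by apply: smooth_onB => //; exact: smooth_onM.
Qed.

Lemma bump_center (R : realType) m (a : 'rV[R]_m) (e : R) : 0 < e -> bump a e a != 0.
Proof.
move=> e0; apply/prodf_neq0 => j _; rewrite subrr expr0n subr0 /flat_exp.
by rewrite exprn_gt0 // expr0 mul1r gt_eqF // expR_gt0.
Qed.

Definition box (R : realType) m (a : 'rV[R]_m) (e : R) : set 'rV[R]_m :=
  [set x | forall j, x 0 j \in `[a 0 j - e, a 0 j + e]].

Lemma bump_out (R : realType) m (a : 'rV[R]_m) (e : R) x :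
  0 < e -> ~ box a e x -> bump a e x = 0.
Proof.
move=> e0; rewrite /box /= => nx; apply/eqP/prodf_eq0.
have /existsNP[j /negP nj] := nx; exists j => //.
rewrite /flat_exp ifF //; apply/negbTE; rewrite -leNgt subr_le0.
move: nj; rewrite in_itv /= -ler_distl -ltNge => /ltW ex.
by rewrite -[leRHS]real_normK ?num_real // ler_sqr // nnegrE ltW.
Qed.

Lemma compact_box (R : realType) m (a : 'rV[R]_m) (e : R) : compact (box a e).
Proof.
apply: (@rV_compact _ _ (fun j => [set` `[a 0 j - e, a 0 j + e]])) => j.
exact: segment_compact.
Qed.

Lemma box_sub (R : realType) m (a : 'rV[R]_m) (U : set 'rV[R]_m) :
  open U -> U a -> exists2 e : R, 0 < e & box a e `<=` U.
Proof.
move=> oU Ua; have [d /= d0 dU] := (nbhs_ballP _ _).1 (open_nbhs_nbhs (conj oU Ua)).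
exists (d / 2); first by rewrite divr_gt0.
move=> x bx; apply: dU; split=> // i j; rewrite (ord1 i) /ball /= distrC.
have := bx j; rewrite in_itv /= -ler_distl => /le_lt_trans; apply.
by rewrite ltr_pdivrMr // ltr_pMr // ltr1n.
Qed.

(** * Global vector fields through a given tangent vector *)

(* The charts of a manifold, not the coordinates in a basis. *)
Local Notation coord := Defs.coord.

Section manifold_charts.
Context {R : realType} {m : nat} {M : manifold R m}.
Implicit Types (c d : atlas M) (p q : M).

Local Notation img c := (coord c @` dom c).

Lemma paramK c x : img c x -> coord c (param c x) = x.
Proof. by move=> [p cp <-]; rewrite coordK. Qed.

Lemma param_dom c x : img c x -> dom c (param c x).
Proof. by move=> [p cp <-]; rewrite coordK. Qed.

Lemma img_coord c p : dom c p -> img c (coord c p).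
Proof. by move=> cp; exists p. Qed.

(** Coordinates are homeomorphisms onto open sets. *)
Lemma open_chart_image c (O : set M) : open O -> open (coord c @` (dom c `&` O)).
Proof.
move=> oO; have cont := @param_continuous _ _ M c.
rewrite continuous_open_subspace in cont; last exact: coord_open.
rewrite openE => _ [p [cp Op] <-].
have xI := img_coord cp.
have nI : nbhs (coord c p) (img c) by apply: open_nbhs_nbhs; split=> //; exact: coord_open.
have nO : nbhs (coord c p) (param c @^-1` O).
  apply: (cont _ (mem_set xI)); rewrite coordK //.
  exact: (open_nbhs_nbhs (conj oO Op)).
apply: filterS (filterI nI nO) => x [Ix Ox]; exists (param c x).
  by split=> //; exact: param_dom.
exact: paramK.
Qed.

Lemma img_overlap c d p : dom c p -> dom d p ->
  (coord c @` (dom c `&` dom d)) (coord c p).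
Proof. by move=> cp dp; exists p. Qed.

Lemma differentiable_transition c d x :
  (coord c @` (dom c `&` dom d)) x ->
  differentiable (fun y => coord d (param c y)) x.
Proof.
move=> Ix; apply: differentiable_mx => i j; rewrite (ord1 i).
exact: smooth_on_diff (@transition_smooth _ _ M c d j) Ix.
Qed.

Lemma transitionE c d p i k : dom c p -> dom d p ->
  transition c d p i k = 'D_('e_i) (fun x => coord d (param c x) 0 k) (coord c p).
Proof.
move=> cp dp; have dT := differentiable_transition (img_overlap cp dp).
have := deriveEjacobian 'e_i dT; rewrite -rowE => /matrixP/(_ 0 k).
rewrite [RHS]mxE /transition => <-.
by rewrite derive_mx ?mxE //; exact: diff_derivable.
Qed.

Lemma transition_id c p : dom c p -> transition c c p = 1%:M.
Proof.
move=> cp; apply/matrixP => i k; rewrite transitionE //.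
have -> : 'D_('e_i) (fun x => coord c (param c x) 0 k) (coord c p)
    = 'D_('e_i) (fun x : 'rV[R]_m => x 0 k) (coord c p).
  apply: near_eq_derive.
  apply: filterS (open_nbhs_nbhs (conj (@coord_open _ _ M c) (img_coord cp))) => y Iy.
  by rewrite paramK.
by rewrite derive_coord !mxE eqxx eq_sym.
Qed.

(** The cocycle condition of the transition maps is the chain rule. *)
Lemma transition_comp c d (e : atlas M) p : dom c p -> dom d p -> dom e p ->
  transition c d p *m transition d e p = transition c e p.
Proof.
move=> cp dp ep; apply/matrixP => i k; rewrite [LHS]mxE.
apply: esym; apply: etrans (transitionE i k cp ep) _.
pose F (y : 'rV[R]_m) : R := coord e (param d y) 0 k.
have oI := open_chart_image (c := c) (@dom_open _ _ M d).
have -> : 'D_('e_i) (fun x => coord e (param c x) 0 k) (coord c p)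
    = 'D_('e_i) (fun x => F (coord d (param c x))) (coord c p).
  apply: near_eq_derive.
  apply: filterS (open_nbhs_nbhs (conj oI (img_overlap cp dp))) => y.
  by move=> [q [cq dq] <-]; rewrite /F !coordK.
rewrite (@derive_comp_rV _ _ _ F); last 2 first.
- by apply: differentiable_transition; exact: img_overlap.
- rewrite coordK //.
  exact: smooth_on_diff (@transition_smooth _ _ M d e k) (img_overlap dp ep).
apply: eq_bigr => j _.
rewrite (coordK cp); apply: esym.
exact: congr2 (transitionE i j cp dp) (transitionE j k dp ep).
Qed.

(** The constant field [u] of the chart [c], cut off by a bump function. *)
Definition bump_field c (a : 'rV[R]_m) (e : R) (u : 'rV[R]_m) : field M :=
  fun d q => if q \in dom c then bump a e (coord c q) *: (u *m transition c d q)
             else 0.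

Lemma bump_field_in c d a (e : R) u q : dom c q ->
  bump_field c a e u d q = bump a e (coord c q) *: (u *m transition c d q).
Proof. by move=> cq; rewrite /bump_field (mem_set cq). Qed.

Lemma bump_field_out c d a (e : R) u q : ~ dom c q -> bump_field c a e u d q = 0.
Proof. by move=> cq; rewrite /bump_field (memNset cq). Qed.

(** In another chart [d], near a point of [dom c] the components are smooth by
composition with the transition maps.  Every other point lies outside the image
of the box under [param c], which is compact, hence closed as the manifold is
Hausdorff; so the field vanishes near it. *)
Lemma bump_field_vector c a (e : R) u : 0 < e -> box a e `<=` img c ->
  vector_field (bump_field c a e u).
Proof.
move=> e0 ac; split=> [d i|d d' q dq d'q]; last first.
  have [cq|ncq] := pselect (dom c q); last by rewrite !bump_field_out // mul0mx.
  by rewrite !bump_field_in // -scalemxAl -mulmxA transition_comp.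
apply: smooth_on_local => x Ix; have [q dq qx] := Ix.
have [cq|ncq] := pselect (dom c q).
  exists (coord d @` (dom d `&` dom c)); first by exists q.
  have oI := open_chart_image (c := d) (@dom_open _ _ M c).
  have cI y : (coord d @` (dom d `&` dom c)) y ->
      (coord c @` (dom c `&` dom d)) (coord c (param d y)).
    by move=> [p [dp cp] <-]; rewrite coordK //; exists p.
  have sT j := @transition_smooth _ _ M d c j.
  have H : smooth_on (coord d @` (dom d `&` dom c))
     (fun y => bump a e (coord c (param d y)) * \sum_j u 0 j *
        'D_('e_j) (fun z => coord d (param c z) 0 i) (coord c (param d y))).
    apply: smooth_onM => //.
      apply: (@smooth_on_comp _ _ _ _ [set: _] (bump a e)
        (fun y => coord c (param d y))) => //.
      by apply: smooth_bump; exact: openT.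
    apply: smooth_on_sum => // j _; apply: smooth_onM => //.
      exact: smooth_on_cst.
    apply: (@smooth_on_comp _ _ _ _ (coord c @` (dom c `&` dom d))
      (fun z => 'D_('e_j) (fun z => coord d (param c z) 0 i) z)
      (fun y => coord c (param d y))) => //.
    by apply: smooth_on_partial; exact: transition_smooth.
  apply: smooth_on_eq H => // _ /set_mem [p [dp cp] <-].
  rewrite coordK // bump_field_in // [RHS]mxE [X in _ = _ * X]mxE; congr (_ * _).
  apply: eq_bigr => j _; congr (_ * _).
  exact: esym (transitionE j i cp dp).
pose K := param c @` box a e.
have cK : closed K.
  apply: compact_closed; first exact: manifold_hausdorff.
  apply: continuous_compact; last exact: compact_box.
  by apply: continuous_subspaceW ac _; exact: param_continuous.
have qK : ~ K q by move=> [y /ac /param_dom + yq]; rewrite yq.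
exists (coord d @` (dom d `&` ~` K)); first by exists q.
have oI : open (coord d @` (dom d `&` ~` K)) by apply: open_chart_image; exact: closed_openC.
apply: (smooth_on_eq oI _ (@smooth_on_cst _ _ _ (0 : R))) => _ /set_mem [p [dp Kp] <-].
rewrite coordK //; have [cp|ncp] := pselect (dom c p); last first.
  by rewrite bump_field_out // mxE.
rewrite bump_field_in // bump_out ?scale0r ?mxE // => bp; apply: Kp; exists (coord c p) => //.
exact: coordK.
Qed.

(** Tensor identities assumed for global vector fields hold for arbitrary tangent
vectors at a point through this extension; the bump function is rescaled to take
the value [1] at [p]. *)
Lemma vector_field_through c p (u : 'rV[R]_m) : dom c p ->
  exists2 X : field M, vector_field X & X c p = u.
Proof.
move=> cp; have [e e0 eI] := box_sub (@coord_open _ _ M c) (img_coord cp).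
have b0 := bump_center (coord c p) e0.
exists (bump_field c (coord c p) e ((bump (coord c p) e (coord c p))^-1 *: u)).
  exact: bump_field_vector.
rewrite bump_field_in // transition_id // mulmx1 scalerA divff //.
exact: scale1r.
Qed.

End manifold_charts.

(** * The contraction at a point *)

Section bilinear_forms.
Context {F : fieldType} {m : nat}.
Implicit Types (A : 'M[F]_m) (u v w : 'rV[F]_m).

Definition form A u v : F := (u *m A *m v^T) 0 0.

Lemma formDl A u v w : form A (u + v) w = form A u w + form A v w.
Proof. by rewrite /form !mulmxDl mxE. Qed.

Lemma formZl A a u w : form A (a *: u) w = a * form A u w.
Proof. by rewrite /form -!scalemxAl mxE. Qed.

Lemma form_sym A u v : A^T = A -> form A u v = form A v u.
Proof.
by move=> sA; rewrite /form -[in RHS]sA -[v in RHS]trmxK -!trmx_mul [RHS]mxE mulmxA.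
Qed.

Lemma formDr A u v w : form A u (v + w) = form A u v + form A u w.
Proof. by rewrite /form linearD /= mulmxDr mxE. Qed.

Lemma formZr A a u v : form A u (a *: v) = a * form A u v.
Proof. by rewrite /form linearZ /= -scalemxAr mxE. Qed.

Lemma form_sum A u v : form A u v = \sum_i u 0 i * form A 'e_i v.
Proof.
rewrite {1}/form -mulmxA mxE; apply: eq_bigr => i _.
by rewrite /form -mulmxA -rowE [in RHS]mxE.
Qed.

Lemma trace_form A u v : \sum_i form A 'e_i v * u 0 i = form A u v.
Proof. by rewrite form_sum; apply: eq_bigr => i _; rewrite mulrC. Qed.

Lemma trace_scale (a : F) : \sum_(i < m) (a *: ('e_i : 'rV[F]_m)) 0 i = a * m%:R.
Proof.
rewrite (eq_bigr (fun=> a)); last by move=> i _; rewrite !mxE !eqxx mulr1.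
by rewrite sumr_const card_ord mulr_natr.
Qed.

End bilinear_forms.

Section curvature_algebra.
Context {F : realFieldType} {m : nat}.
Variables (G : 'M[F]_m) (C : 'I_m -> 'I_m -> 'M[F]_m).
Hypotheses (symG : G^T = G) (unitG : G \in unitmx).
Implicit Types (u v w z : 'rV[F]_m).

Definition curv_op u v : 'M[F]_m := \sum_i \sum_j (u 0 i * v 0 j) *: C i j.

(** The trace of [w |-> R(w, u) v], as a bilinear form in [u] and [v]. *)
Definition ric_mx : 'M[F]_m := \matrix_(j, k) \sum_i C i j k i.

Hypothesis skewC : forall i j, (C i j *m G)^T = - (C i j *m G).
Hypothesis bianchiC : forall i j k l, C i j k l + C j k i l + C k i j l = 0.
Hypothesis antiC : forall i j, C j i = - C i j.

Lemma curv_opD u v w : curv_op (u + v) w = curv_op u w + curv_op v w.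
Proof.
rewrite /curv_op -big_split; apply: eq_bigr => i _; rewrite -big_split.
by apply: eq_bigr => j _; rewrite mxE mulrDl scalerDl.
Qed.

Lemma curv_opZ a u w : curv_op (a *: u) w = a *: curv_op u w.
Proof.
rewrite /curv_op scaler_sumr; apply: eq_bigr => i _; rewrite scaler_sumr.
by apply: eq_bigr => j _; rewrite mxE scalerA mulrA.
Qed.

Lemma curv_op_skew u v : (curv_op u v *m G)^T = - (curv_op u v *m G).
Proof.
rewrite /curv_op mulmx_suml linear_sum -sumrN; apply: eq_bigr => i _ /=.
rewrite mulmx_suml linear_sum -sumrN; apply: eq_bigr => j _ /=.
by rewrite -scalemxAl linearZ /= skewC scalerN.
Qed.

Lemma form_curv_skew u v w z :
  form G (w *m curv_op u v) z = - form G (z *m curv_op u v) w.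
Proof.
rewrite /form -!(mulmxA _ (curv_op u v)).
have -> : (w *m (curv_op u v *m G) *m z^T) 0 0
    = (z *m (curv_op u v *m G)^T *m w^T) 0 0.
  by rewrite -[w *m _ *m _]trmxK mxE !trmx_mul !trmxK mulmxA.
by rewrite curv_op_skew mulmxN mulNmx mxE.
Qed.

Lemma ric_traceE u v : \sum_i (v *m curv_op 'e_i u) 0 i = form ric_mx u v.
Proof.
have E i : curv_op 'e_i u = \sum_j u 0 j *: C i j.
  rewrite /curv_op (bigD1 i) //= [X in _ + X]big1 ?addr0; last first.
    move=> k ki; apply: big1 => j _.
    by rewrite mxE eqxx (negPf ki) mul0r scale0r.
  by apply: eq_bigr => j _; rewrite mxE !eqxx mul1r.
transitivity (\sum_i \sum_k \sum_j u 0 j * v 0 k * C i j k i).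
  apply: eq_bigr => i _; rewrite E [LHS]mxE; apply: eq_bigr => k _.
  rewrite summxE mulr_sumr; apply: eq_bigr => j _.
  by rewrite mxE; ring.
rewrite /form mxE exchange_big; apply: eq_bigr => k _ /=.
rewrite exchange_big mxE mulr_suml; apply: eq_bigr => j _ /=.
by rewrite !mxE mulrAC mulr_sumr.
Qed.

(** By the Bianchi identity the antisymmetric part of the Ricci tensor is the
trace of a curvature operator, which vanishes as these are skew. *)
Lemma ric_mx_sym : ric_mx^T = ric_mx.
Proof.
have tr0 i j : \tr (C i j) = 0.
  have E : \tr (C i j) = - \tr (C i j).
    rewrite -{1}[C i j](mulmxK unitG) -mxtrace_tr trmx_mul skewC mulmxN.
    by rewrite raddfN /= trmx_inv symG mxtrace_mulC mulmxK.
  by apply/eqP; rewrite -[_ == 0](mulrn_eq0 _ 2) mulr2n {1}E addNr.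
apply/matrixP => j k; rewrite !mxE; apply/eqP; rewrite -subr_eq0 -sumrB.
rewrite (eq_bigr (fun i => C j k i i)); first by rewrite -[X in X == 0]/(\tr (C j k)) tr0.
move=> i _; have := bianchiC i j k i; have := antiC i k; move=> /matrixP/(_ j i).
by rewrite mxE => -> E; lra.
Qed.

End curvature_algebra.

Section phi_flatness.
Context {F : realFieldType} {m : nat}.
Variables (G Phi : 'M[F]_m) (C : 'I_m -> 'I_m -> 'M[F]_m).
Variables (xi : 'rV[F]_m) (eta : 'cV[F]_m) (kappa : F).
Implicit Types (u v w z : 'rV[F]_m).
Hypotheses (symG : G^T = G) (unitG : G \in unitmx).
Hypothesis posG : forall v, v != 0 -> 0 < form G v v.
Hypothesis skewC : forall i j, (C i j *m G)^T = - (C i j *m G).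
Hypothesis bianchiC : forall i j k l, C i j k l + C j k i l + C k i j l = 0.
Hypothesis antiC : forall i j, C j i = - C i j.
Hypotheses (PhiK : Phi *m Phi = - 1%:M + eta *m xi).
Hypotheses (eta_xi : (xi *m eta) 0 0 = 1) (xi_Phi : xi *m Phi = 0).
Hypothesis Phi_metric : forall u v, form G (u *m Phi) (v *m Phi)
  = form G u v - (u *m eta) 0 0 * (v *m eta) 0 0.
Local Notation Rm u v w := (w *m curv_op C u v).
Local Notation Ric := (form (ric_mx C)).
Local Notation g := (form G).
Local Notation ev u := (((u : 'rV[F]_m) *m eta) 0 0).
Hypothesis Nkappa : forall u v, Rm u v xi = kappa *: (ev v *: u - ev u *: v).

(** The compatibility of the metric with [xi] as one argument shows that [eta] is
the metric dual of [xi]. *)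
Lemma ev_metric u : ev u = g u xi.
Proof.
have := Phi_metric u xi; rewrite xi_Phi eta_xi mulr1 {1}/form linear0 mulmx0 mxE.
by move/eqP; rewrite eq_sym subr_eq0 => /eqP.
Qed.

Lemma evD u v : ev (u + v) = ev u + ev v.
Proof. by rewrite mulmxDl mxE. Qed.

Lemma evZ a u : ev (a *: u) = a * ev u.
Proof. by rewrite -scalemxAl mxE. Qed.

Lemma ev_sum u : ev u = \sum_i u 0 i * ev 'e_i.
Proof.
have E i : ev ('e_i : 'rV[F]_m) = eta i 0 by rewrite -rowE mxE.
by rewrite [LHS]mxE; apply: eq_bigr => i _; rewrite E.
Qed.

(** On the kernel of [eta] the structure tensor squares to [- 1]. *)
Lemma horizontal_Phi u : ev u = 0 -> u = (- (u *m Phi)) *m Phi.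
Proof.
move=> eu; rewrite mulNmx -mulmxA PhiK mulmxDr mulmxN mulmx1 mulmxA.
by rewrite [u *m eta]mx11_scalar eu mul_scalar_mx scale0r addr0 opprK.
Qed.

Lemma ric_xi u : Ric u xi = kappa * (m%:R - 1) * ev u.
Proof.
rewrite -ric_traceE.
transitivity (\sum_i ((kappa * ev u) *: ('e_i : 'rV[F]_m)) 0 i
              - kappa * \sum_i u 0 i * ev 'e_i).
  rewrite mulr_sumr -sumrB; apply: eq_bigr => i _.
  by rewrite Nkappa [LHS]mxE [X in _ * X]mxE [X in _ * (X + _)]mxE
    [X in _ * (_ + X)]mxE [X in _ * (_ - X)]mxE [X in _ = X - _]mxE; ring.
by rewrite trace_scale -ev_sum; ring.
Qed.

Lemma ev_curv v w : ev v = 0 -> ev (Rm xi v w) = kappa * g v w.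
Proof.
move=> v0; rewrite ev_metric (form_curv_skew skewC) Nkappa v0 scale0r sub0r.
rewrite eta_xi scale1r formZl -[- v]scaleN1r formZl; ring.
Qed.

(** The full trace is the trace over the kernel of [eta], which is zero for such a
map, plus the contribution of the direction [xi]. *)
Lemma horizontal_trace (f : 'rV[F]_m -> 'rV[F]_m) : linear f ->
  (forall u, ev u = 0 -> f u = ev (f u) *: xi) ->
  \sum_i f 'e_i 0 i = ev (f xi).
Proof.
move=> lf hf.
have fE u a : f (u - a *: xi) = f u - a *: f xi.
  by rewrite [u - _]addrC -scaleNr lf addrC scaleNr.
have f_sum u : f u = \sum_i u 0 i *: f 'e_i.
  pose L : {linear 'rV[F]_m -> 'rV[F]_m} :=
    HB.pack f (GRing.isLinear.Build _ _ _ _ f lf).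
  rewrite {1}[u]row_sum_delta -[f]/(L : _ -> _) linear_sum.
  by apply: eq_bigr => i _; rewrite linearZ.
have H i : f 'e_i 0 i - ev 'e_i * f xi 0 i
   = (ev (f 'e_i) - ev 'e_i * ev (f xi)) * xi 0 i.
  have h : ev ('e_i - ev 'e_i *: xi) = 0.
    by rewrite -scaleNr evD evZ eta_xi mulr1 subrr.
  have := hf _ h; rewrite fE => /rowP/(_ i).
  rewrite -[in RHS]scaleNr [X in X *: xi]evD evZ mulNr [RHS]mxE => <-.
  by rewrite [RHS]mxE [X in _ = _ + X]mxE [X in _ = _ - X]mxE.
have : \sum_i (f 'e_i 0 i - ev 'e_i * f xi 0 i)
   = \sum_i (ev (f 'e_i) - ev 'e_i * ev (f xi)) * xi 0 i.
  by apply: eq_bigr => i _; exact: H.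
rewrite sumrB.
have -> : \sum_i ev 'e_i * f xi 0 i = ev (f xi).
  by rewrite [RHS]ev_sum; apply: eq_bigr => i _; rewrite mulrC.
have -> : \sum_i (ev (f 'e_i) - ev 'e_i * ev (f xi)) * xi 0 i
    = \sum_i xi 0 i * ev (f 'e_i) - ev (f xi) * \sum_i xi 0 i * ev 'e_i.
  by rewrite mulr_sumr -sumrB; apply: eq_bigr => i _; ring.
rewrite -ev_sum eta_xi mulr1.
have -> : \sum_i xi 0 i * ev (f 'e_i) = ev (f xi).
  rewrite [in RHS]f_sum mulmx_suml summxE.
  by apply: eq_bigr => i _; rewrite evZ.
by rewrite subrr => /eqP; rewrite subr_eq0 => /eqP.
Qed.

Variables (r : F) (a0 a1 a2 a3 a4 a5 a6 a7 : F).
Definition ric_op u : 'rV[F]_m := u *m ric_mx C *m invmx G.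
Hypothesis rE : r = \sum_i ric_op 'e_i 0 i.

Definition T_op u v w : 'rV[F]_m :=
  a0 *: Rm u v w + (a1 * Ric v w) *: u + (a2 * Ric u w) *: v
  + (a3 * Ric u v) *: w + (a4 * g v w) *: ric_op u + (a5 * g u w) *: ric_op v
  + (a6 * g u v) *: ric_op w + (a7 * r) *: (g v w *: u - g u w *: v).

Lemma form_ric_op u v : g (ric_op u) v = Ric u v.
Proof. by rewrite /form /ric_op mulmxKV. Qed.

Hypothesis flat : forall u v w z,
  form G (T_op (u *m Phi) (v *m Phi) (w *m Phi)) (z *m Phi) = 0.

(** Flatness makes the vector orthogonal to the kernel of [eta]; its horizontal
part is thus orthogonal to itself. *)
Lemma T_op_horizontal u v w : ev u = 0 -> ev v = 0 -> ev w = 0 ->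
  T_op u v w = ev (T_op u v w) *: xi.
Proof.
move=> u0 v0 w0; set t := T_op u v w.
pose z := t - ev t *: xi.
have z0 : ev z = 0 by rewrite /z -scaleNr evD evZ eta_xi mulr1 subrr.
have tz : g t z = 0.
  rewrite /t (horizontal_Phi u0) (horizontal_Phi v0) (horizontal_Phi w0).
  rewrite (horizontal_Phi z0); exact: flat.
have zz : g z z = 0.
  rewrite {1}/z -scaleNr formDl formZl tz add0r (form_sym _ _ symG) -ev_metric.
  by rewrite z0 mulr0.
apply/eqP; rewrite -subr_eq0 -/z; apply: contraT => /posG.
by rewrite zz ltxx.
Qed.

Lemma T_op_linear v w : linear (fun u => T_op u v w).
Proof.
move=> a u u'; rewrite /T_op /ric_op !(formDl, formZl, curv_opD, curv_opZ).
rewrite !(mulmxDr, mulmxDl) -!scalemxAr -!scalemxAl.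
apply/rowP => i.
move: (ric_mx C) (curv_op C u v) (curv_op C u' v) => S A B.
move: (w *m A) (w *m B) (u *m S *m _) (u' *m S *m _) (v *m S *m _) (w *m S *m _).
by move=> wA wB uS uS' vS wS; rewrite !mxE; ring.
Qed.

Lemma trace_T_op v w : \sum_i T_op 'e_i v w 0 i
  = (a0 + m%:R * a1 + a2 + a3 + a5 + a6) * Ric v w
    + (a4 * r + a7 * r * (m%:R - 1)) * g v w.
Proof.
have symS : (ric_mx C)^T = ric_mx C.
  exact: ric_mx_sym symG unitG skewC bianchiC antiC.
transitivity (\sum_i (a0 * (w *m curv_op C 'e_i v) 0 i
  + (a1 * Ric v w) * ('e_i : 'rV[F]_m) 0 i
  + a2 * (Ric 'e_i w * v 0 i) + a3 * (Ric 'e_i v * w 0 i)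
  + (a4 * g v w) * ric_op 'e_i 0 i
  + a5 * (g 'e_i w * ric_op v 0 i) + a6 * (g 'e_i v * ric_op w 0 i)
  + (a7 * r) * (g v w * ('e_i : 'rV[F]_m) 0 i - g 'e_i w * v 0 i))).
  apply: eq_bigr => i _; rewrite /T_op; move: (w *m _) (ric_op _) (ric_op _) (ric_op _).
  by move: (delta_mx _ _) => e c q1 q2 q3; rewrite !mxE; ring.
have tr1 : \sum_(i < m) ('e_i : 'rV[F]_m) 0 i = m%:R.
  by have := @trace_scale F m 1; rewrite mul1r => <-; apply: eq_bigr => i _; rewrite scale1r.
rewrite !big_split /= -!mulr_sumr sumrB -!mulr_sumr !trace_form !form_ric_op -rE.
rewrite tr1 ric_traceE (form_sym w v symS); ring.
Qed.

Lemma ev_T_op v w : ev v = 0 -> ev w = 0 -> ev (T_op xi v w)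
  = a1 * Ric v w + (a0 * kappa + a4 * (kappa * (m%:R - 1)) + a7 * r) * g v w.
Proof.
move=> v0 w0.
have symS : (ric_mx C)^T = ric_mx C.
  exact: ric_mx_sym symG unitG skewC bianchiC antiC.
rewrite /T_op -[- (_ *: v)]scaleNr !(evD, evZ) ev_curv //.
have Rx u : ev u = 0 -> Ric xi u = 0.
  by move=> u0; rewrite (form_sym _ _ symS) ric_xi u0 mulr0.
have gx u : ev u = 0 -> g xi u = 0 by move=> u0; rewrite (form_sym _ _ symG) -ev_metric.
have Qx : ev (ric_op xi) = kappa * (m%:R - 1).
  by rewrite ev_metric form_ric_op ric_xi eta_xi mulr1.
rewrite !Rx // !gx // v0 w0 eta_xi Qx; ring.
Qed.

Lemma horizontal_ricci v w : ev v = 0 -> ev w = 0 ->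
  (a0 + (m%:R - 1) * a1 + a2 + a3 + a5 + a6) * Ric v w
  = (a0 * kappa + a4 * ((m%:R - 1) * kappa - r) + a7 * r * (2 - m%:R)) * g v w.
Proof.
move=> v0 w0.
have H u : ev u = 0 -> T_op u v w = ev (T_op u v w) *: xi.
  by move=> u0; exact: T_op_horizontal.
have := horizontal_trace (T_op_linear v w) H.
rewrite trace_T_op ev_T_op // => E.
apply/eqP; rewrite -subr_eq0; apply/eqP.
move/eqP: E; rewrite -subr_eq0 => /eqP <-; ring.
Qed.

(** Splitting both arguments into a horizontal part and a multiple of [xi] reduces
to [horizontal_ricci] and [ric_xi]. *)
Lemma flat_ricci u v : let c2 := a0 + (m%:R - 1) * a1 + a2 + a3 + a5 + a6 in
  let b := (a0 * kappa + a4 * ((m%:R - 1) * kappa - r) + a7 * r * (2 - m%:R)) / c2 in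
  c2 != 0 ->
  Ric u v = b * g u v + ((m%:R - 1) * kappa - b) * (ev u * ev v).
Proof.
move=> c2 b c20.
have symS : (ric_mx C)^T = ric_mx C.
  exact: ric_mx_sym symG unitG skewC bianchiC antiC.
have hor w : ev (w - ev w *: xi) = 0.
  by rewrite -scaleNr evD evZ eta_xi mulr1 subrr.
have H : Ric (u - ev u *: xi) (v - ev v *: xi) = b * g (u - ev u *: xi) (v - ev v *: xi).
  apply: (mulfI c20); rewrite horizontal_ricci // /b mulrA mulrCA.
  by rewrite mulfV // mulr1.
have xx : g xi xi = 1 by rewrite -ev_metric.
have xw w : g xi w = ev w by rewrite (form_sym _ _ symG) -ev_metric.
have rw w : Ric xi w = kappa * (m%:R - 1) * ev w by rewrite (form_sym _ _ symS) ric_xi.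
clearbody b; apply/eqP; rewrite -subr_eq0; apply/eqP.
rewrite -!scaleNr !(formDl, formDr, formZl, formZr) !ric_xi !rw !xw -!ev_metric
  eta_xi in H.
move/eqP: H; rewrite -subr_eq0 => /eqP H; rewrite -[RHS]H; ring.
Qed.

End phi_flatness.

(** * The tensors of the manifold in a chart *)

Section geometry_in_a_chart.
Context {R : realType} {m : nat} {M : manifold R m} (K : contact_data M).
Hypotheses (tK : tensor_fields K) (rK : riemannian K).
Variable c : atlas M.
Local Notation U := (coord c @` dom c).
Local Notation G := (fun x => g K c (param c x)).
Implicit Types (X Y Z : field M) (p : M).

Definition pull X (x : 'rV[R]_m) : 'rV[R]_m := X c (param c x).

Lemma chart_open : open U.
Proof. exact: coord_open. Qed.

Lemma pull_coord X p : dom c p -> pull X (coord c p) = X c p.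
Proof. by move=> cp; rewrite /pull coordK. Qed.

Lemma smooth_pull X : vector_field X -> smooth_mx U (pull X).
Proof. by move=> [sX _] a b; rewrite (ord1 a); exact: sX. Qed.

Lemma smooth_pull_phi X : smooth_mx U (pull X) -> smooth_mx U (pull (phi_of K X)).
Proof.
move=> sX; have [/(_ c)[sphi _ _] _ _] := tK.
have H := smooth_mxM chart_open sX (sphi : smooth_mx U (fun x => phi K c (param c x))).
exact: H.
Qed.

Lemma smooth_pull_coord i : smooth_mx U (pull (coord_field M i)).
Proof. by move=> a b; exact: smooth_on_cst. Qed.

Lemma smooth_G : smooth_mx U G.
Proof. by have [/(_ c)[_ _ sg] _ _] := tK. Qed.

(** A vector in the kernel of a positive definite matrix has zero norm. *)
Lemma metric_unitmx p : dom c p -> g K c p \in unitmx.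
Proof.
move=> cp; have [_ pos] := rK cp.
rewrite -row_free_unit -kermx_eq0; apply/rowV0P => v /sub_kermxP v0.
apply/eqP; apply: contraT => /pos.
by rewrite v0 mul0mx mxE ltxx.
Qed.

Lemma G_sym x : U x -> (G x)^T = G x.
Proof. by move=> /param_dom cp; have [] := rK cp. Qed.

Lemma G_unit x : U x -> G x \in unitmx.
Proof. by move=> /param_dom; exact: metric_unitmx. Qed.

Lemma christoffelE k i j p : dom c p ->
  christoffel K c p k i j = conn_mx G i (coord c p) j k.
Proof.
move=> cp; rewrite /conn_mx coordK // [RHS]mxE /christoffel mulr_sumr.
apply: eq_bigr => l _; rewrite [X in _ = _ * X]mxE christoffel1E !dmxE /partial.
by rewrite mulrCA [RHS]mulrC.
Qed.

Lemma nabla_cov X Y p : dom c p ->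
  nabla K X Y c p = cov_deriv G (pull X) (pull Y) (coord c p).
Proof.
move=> cp; apply/rowP => k; rewrite [LHS]mxE /cov_deriv summxE /along -big_split.
apply: eq_bigr => i _ /=; rewrite !pull_coord // [RHS]mxE [X in _ = _ * X]mxE.
rewrite [RHS]mulrDr dmxE; congr (_ + _).
rewrite [X in _ = _ * X]mxE mulr_sumr; apply: eq_bigr => j _.
by rewrite christoffelE // [RHS]mulrA [RHS]mulrC mulrA.
Qed.

Lemma cov_eq (X1 X2 Y1 Y2 : 'rV[R]_m -> 'rV[R]_m) x : U x ->
  X1 x = X2 x -> (forall y, U y -> Y1 y = Y2 y) -> cov_deriv G X1 Y1 x = cov_deriv G X2 Y2 x.
Proof.
move=> Ux X12 Y12; rewrite /cov_deriv X12; apply: eq_bigr => i _.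
by rewrite (dmx_eq chart_open i Y12 Ux) Y12.
Qed.

Lemma bracket_lie X Y p : dom c p ->
  bracket X Y c p = lie_bracket (pull X) (pull Y) (coord c p).
Proof.
move=> cp; apply/rowP => k; rewrite [LHS]mxE /lie_bracket summxE /along -sumrB.
apply: eq_bigr => i _; rewrite !pull_coord // [RHS]mxE [X in _ = X + _]mxE.
by rewrite [X in _ = _ + X]mxE [X in _ = _ - X]mxE !dmxE.
Qed.

Lemma pull_nabla X Y x : U x -> pull (nabla K X Y) x = cov_deriv G (pull X) (pull Y) x.
Proof. by move=> Ux; rewrite /pull nabla_cov ?paramK //; exact: param_dom. Qed.

Definition curv_at p (i j : 'I_m) : 'M[R]_m := curv_mx G i j (coord c p).

(** The second covariant derivatives see the first ones in a neighbourhood of [p],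
where these are replaced by their coordinate expressions; the result is then
[cov_commutator]. *)
Lemma curvatureE X Y Z p : dom c p -> smooth_mx U (pull X) ->
  smooth_mx U (pull Y) -> smooth_mx U (pull Z) ->
  curvature K X Y Z c p = Z c p *m curv_op (curv_at p) (X c p) (Y c p).
Proof.
move=> cp sX sY sZ; have Up := img_coord cp.
have -> : curvature K X Y Z c p
    = cov_deriv G (pull X) (cov_deriv G (pull Y) (pull Z)) (coord c p)
      - cov_deriv G (pull Y) (cov_deriv G (pull X) (pull Z)) (coord c p)
      - cov_deriv G (lie_bracket (pull X) (pull Y)) (pull Z) (coord c p).
  rewrite /curvature !nabla_cov //; congr (_ - _ - _); apply: cov_eq => //.
  - by move=> y Uy; exact: pull_nabla.
  - by move=> y Uy; exact: pull_nabla.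
  - by rewrite pull_coord // bracket_lie.
rewrite (cov_commutator chart_open smooth_G G_unit) // !pull_coord //.
rewrite /curv_op mulmx_sumr; apply: eq_bigr => i _; rewrite mulmx_sumr.
by apply: eq_bigr => j _; rewrite scalemxAr.
Qed.

Lemma ricciE X Y p : dom c p -> smooth_mx U (pull X) -> smooth_mx U (pull Y) ->
  ricci K X Y c p = form (ric_mx (curv_at p)) (X c p) (Y c p).
Proof.
move=> cp sX sY; rewrite -ric_traceE; apply: eq_bigr => i _.
by rewrite curvatureE //; exact: smooth_pull_coord.
Qed.

Lemma ricci_opE X p : dom c p -> smooth_mx U (pull X) ->
  ricci_op K X c p = ric_op (g K c p) (curv_at p) (X c p).
Proof.
move=> cp sX; rewrite /ricci_op /ric_op; congr (_ *m _).
apply/rowP => j; rewrite mxE ricciE //; last exact: smooth_pull_coord.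
by rewrite /form trmx_delta -colE mxE.
Qed.

Lemma scalar_curvatureE r p : scalar_curvature K r -> dom c p ->
  r p = \tr (ric_mx (curv_at p) *m invmx (g K c p)).
Proof.
move=> hr cp; rewrite (hr c p cp); apply: eq_bigr => i _.
rewrite ricci_opE //; last exact: smooth_pull_coord.
by rewrite /ric_op -mulmxA -rowE mxE.
Qed.

Lemma smooth_in_scalar_curvature r : scalar_curvature K r -> smooth_in c r.
Proof.
move=> hr; have oU := chart_open.
have sC := smooth_curv_mx oU smooth_G G_unit.
have sS : smooth_mx U (fun x => ric_mx (fun i j => curv_mx G i j x)).
  move=> j k.
  have H : smooth_on U (fun x => \sum_i curv_mx G i j x k i).
    by apply: smooth_on_sum => // i _; exact: sC.
  by apply: (smooth_on_eq oU _ H) => x _; rewrite [RHS]mxE.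
have sQ := smooth_mxM oU sS (smooth_invmx oU G_unit smooth_G).
have H : smooth_on U (fun x =>
    \sum_i (ric_mx (fun i j => curv_mx G i j x) *m invmx (G x)) i i).
  by apply: smooth_on_sum => // i _; exact: sQ.
apply: (smooth_on_eq oU _ H) => x /set_mem Ux.
rewrite (scalar_curvatureE hr (param_dom Ux)) /curv_at.
by rewrite paramK.
Qed.

Lemma T_curvatureE r a X1 X2 X3 p : dom c p -> smooth_mx U (pull X1) ->
  smooth_mx U (pull X2) -> smooth_mx U (pull X3) ->
  T_curvature K r a X1 X2 X3 c p
  = T_op (g K c p) (curv_at p) (r p) (a0 a p) (a1 a p) (a2 a p) (a3 a p)
      (a4 a p) (a5 a p) (a6 a p) (a7 a p) (X1 c p) (X2 c p) (X3 c p).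
Proof.
move=> cp s1 s2 s3.
by rewrite /T_curvature curvatureE // !ricciE // !ricci_opE.
Qed.

End geometry_in_a_chart.

(** Each hypothesis on vector fields is applied to fields through prescribed
vectors at [p], which reduces the claim to [flat_ricci]. *)
Lemma phi_flat_ricci (R : realType) (m : nat) (M : manifold R m)
    (K : contact_data M) (kappa : R) (r : M -> R) (a : coefs M) (c : atlas M) p :
  N_contact_metric K kappa -> scalar_curvature K r -> phi_T_flat K r a ->
  dom c p ->
  let c2 := a0 a p + (m%:R - 1) * a1 a p + a2 a p + a3 a p + a5 a p + a6 a p in
  let b := (a0 a p * kappa + a4 a p * ((m%:R - 1) * kappa - r p)
            + a7 a p * r p * (2 - m%:R)) / c2 in
  c2 != 0 ->
  forall X Y, vector_field X -> vector_field Y ->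
  ricci K X Y c p = b * metric K X Y c p
    + ((m%:R - 1) * kappa - b) * (eta_of K X c p * eta_of K Y c p).
Proof.
move=> [[tK rK alg phi_met _] hN] hr flat cp c2 b c20 X Y vX vY.
have [PhiK eta_xi xi_Phi _] := alg c p cp.
have sG := smooth_G tK (c := c).
have yG := G_sym rK (c := c); have uG := G_unit rK (c := c); have oU := @chart_open _ _ _ c.
have Up := img_coord cp.
have Gp : (fun x => g K c (param c x)) (coord c p) = g K c p by rewrite coordK.
have vxi : vector_field (xi K) by have [] := tK.
rewrite (ricciE tK rK) //; [|exact: smooth_pull..].
have [symG posG] := rK c p cp.
apply: (flat_ricci (Phi := phi K c p) (xi := xi K c p) (eta := eta K c p)) => //.
- exact: (metric_unitmx rK).
- move=> i j; have := curv_mx_skew oU sG yG uG i j Up.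
  by rewrite Gp.
- move=> i j k l.
  by apply: (curv_mx_bianchi oU).
- by move=> i j; exact: curv_mx_anti.
- move=> u v; have [X1 vX1 <-] := vector_field_through u cp.
  have [X2 vX2 <-] := vector_field_through v cp.
  exact: phi_met.
- move=> u v; have [X1 vX1 <-] := vector_field_through u cp.
  have [X2 vX2 <-] := vector_field_through v cp.
  by rewrite -(curvatureE tK rK) //; [exact: hN|exact: smooth_pull..].
- rewrite (hr c p cp); apply: eq_bigr => i _.
  by rewrite (ricci_opE tK rK) //; exact: smooth_pull_coord.
move=> u v w z; have [X1 vX1 <-] := vector_field_through u cp.
have [X2 vX2 <-] := vector_field_through v cp.
have [X3 vX3 <-] := vector_field_through w cp.
have [X4 vX4 <-] := vector_field_through z cp.
have := flat _ _ _ _ vX1 vX2 vX3 vX4 c p cp.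
rewrite /metric (T_curvatureE tK rK) //.
all: by apply: (smooth_pull_phi tK); exact: smooth_pull.
Qed.

(** * phi-T-flat manifolds *)

Section smooth_on_manifold.
Context {R : realType} {m : nat} {M : manifold R m}.
Implicit Types (f h : M -> R).

Lemma smooth_cst (k : R) : smooth (fun=> k : R) (M := M).
Proof. by move=> c; exact: smooth_on_cst. Qed.

Lemma smoothD f h : smooth f -> smooth h -> smooth (fun p => f p + h p).
Proof.
by move=> sf sh c; apply: smooth_onD; [exact: chart_open|exact: sf|exact: sh].
Qed.

Lemma smoothM f h : smooth f -> smooth h -> smooth (fun p => f p * h p).
Proof.
by move=> sf sh c; apply: smooth_onM; [exact: chart_open|exact: sf|exact: sh].
Qed.

Lemma smoothN f : smooth f -> smooth (fun p => - f p).
Proof. by move=> sf c; apply: smooth_onN; [exact: chart_open|exact: sf]. Qed.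

Lemma smoothV f : (forall p, f p != 0) -> smooth f -> smooth (fun p => (f p)^-1).
Proof.
by move=> f0 sf c; apply: smooth_onV; [exact: chart_open|move=> x _; exact: f0|exact: sf].
Qed.

Lemma smooth_const_coefs c0 c1 c2 c3 c4 c5 c6 c7 :
  smooth_coefs (const_coefs M c0 c1 c2 c3 c4 c5 c6 c7).
Proof. by split; split; exact: smooth_cst. Qed.

Lemma smooth_quasi_conformal n f0 f1 :
  smooth f0 -> smooth f1 -> smooth_coefs (quasi_conformal n f0 f1).
Proof.
move=> s0 s1; split; split=> //=; try exact: smooth_cst; try exact: smoothN.
apply: smoothM; first exact: smooth_cst.
apply: smoothD; first by apply: smoothM => //; exact: smooth_cst.
by apply: smoothM => //; exact: smooth_cst.
Qed.

Lemma smooth_pseudo_projective n f0 f1 :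
  smooth f0 -> smooth f1 -> smooth_coefs (pseudo_projective n f0 f1).
Proof.
move=> s0 s1; split; split=> //=; try exact: smooth_cst; try exact: smoothN.
apply: smoothM; first exact: smooth_cst.
apply: smoothD => //; by apply: smoothM => //; exact: smooth_cst.
Qed.

End smooth_on_manifold.

Section phi_flat_manifolds.
Context {R : realType} {n : nat} {M : manifold R (2 * n)%N.+1}.
Context {K : contact_data M} {kappa : R} {r : M -> R}.
Hypotheses (hN : N_contact_metric K kappa) (hr : scalar_curvature K r).

Lemma phi_flat_ricci_form a : phi_T_flat K r a -> (forall p, C2 n a p != 0) ->
  ricci_form K (fun p => A2 n kappa r a p / C2 n a p)
    (fun p => 2 * n%:R * kappa - A2 n kappa r a p / C2 n a p).
Proof.
move=> flat C0 X Y vX vY c p cp.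
have dimE : (2 * n)%N.+1%:R - 1 = 2 * n%:R :> R by rewrite -natr1 addrK natrM.
have dimE2 : 2 - (2 * n)%N.+1%:R = 1 - 2 * n%:R :> R.
  by rewrite -dimE; ring.
have := phi_flat_ricci hN hr flat cp _ vX vY.
by rewrite dimE dimE2; apply; exact: C0.
Qed.

Lemma smooth_scalar_curvature : smooth r.
Proof.
have [[tK rK _ _ _] _] := hN.
by move=> c; exact: (smooth_in_scalar_curvature tK rK).
Qed.

Lemma smooth_A2_C2 a : smooth_coefs a -> (forall p, C2 n a p != 0) ->
  smooth (fun p => A2 n kappa r a p / C2 n a p).
Proof.
move=> [[s0 s1 s2 s3] [s4 s5 s6 s7]] C0; have sr := smooth_scalar_curvature.
have sc k := @smooth_cst _ _ M k.
apply: smoothM; last apply: smoothV => //.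
  apply: smoothD; [apply: smoothD|]; apply: smoothM => //.
  - by apply: smoothD => //; exact: smoothN.
  - exact: smoothM.
by do 5! apply: smoothD => //; apply: smoothM.
Qed.

Lemma phi_flat_eta_einstein a : smooth_coefs a -> phi_T_flat K r a ->
  (forall p, C2 n a p != 0) -> eta_einstein K.
Proof.
move=> sa flat C0.
exists (fun p => A2 n kappa r a p / C2 n a p).
exists (fun p => 2 * n%:R * kappa - A2 n kappa r a p / C2 n a p).
have sQ := smooth_A2_C2 sa C0.
split=> //; last exact: phi_flat_ricci_form.
by apply: smoothD; [exact: smooth_cst|exact: smoothN].
Qed.

(** The functions are compared with [A2 / C2] by cross multiplication, so that for
each special tensor only a polynomial identity in the coefficients is left. *)
Lemma flat_gives_eta_einsteinP a (b1 b2 : M -> R) : smooth_coefs a ->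
  (forall p, C2 n a p != 0 -> b1 p * C2 n a p = A2 n kappa r a p) ->
  (forall p, b2 p = 2 * n%:R * kappa - b1 p) ->
  flat_gives_eta_einstein n K r a b1 b2.
Proof.
move=> sa b1E b2E C0 flat; split; last exact: phi_flat_eta_einstein flat C0.
move=> X Y vX vY c p cp; rewrite (phi_flat_ricci_form flat C0 vX vY cp).
by rewrite -b1E // b2E mulfK.
Qed.

Lemma flat_gives_einsteinP a : smooth_coefs a ->
  (forall p, C2 n a p != 0 -> 2 * n%:R * kappa * C2 n a p = A2 n kappa r a p) ->
  flat_gives_einstein n K r a (fun=> 2 * n%:R * kappa).
Proof.
move=> sa bE C0 flat.
have [|rf _] := @flat_gives_eta_einsteinP a (fun=> 2 * n%:R * kappa) (fun=> 0) sa bE _ C0 flat.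
  by move=> _; rewrite subrr.
split=> //; exists (fun=> 2 * n%:R * kappa), (fun=> 0).
by split=> //; exact: smooth_cst.
Qed.

End phi_flat_manifolds.

Theorem theorem3 (R : realType) (n : nat) (n_gt0 : (0 < n)%N)
    (M : manifold R (2 * n)%N.+1) (K : contact_data M) (kappa : R)
    (hN : N_contact_metric K kappa)
    (r : M -> R) (hr : scalar_curvature K r) :
  (forall a : coefs M, smooth_coefs a -> phi_T_flat K r a ->
     (forall p, C2 n a p != 0) ->
     ricci_form K (fun p => A2 n kappa r a p / C2 n a p)
       (fun p => 2 * n%:R * kappa - A2 n kappa r a p / C2 n a p)
     /\ eta_einstein K)
  /\
  ((forall p, r p = 2 * n%:R * (2 * n%:R - 2 + kappa)) ->
   (forall f0 f1 : M -> R, smooth f0 -> smooth f1 ->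
      let f := fun p =>
        ((2 * n%:R - 1) * (kappa + 2 * n%:R - 2) * (4 * n%:R * f1 p + f0 p)
           / (2 * n%:R + 1)
         + f0 p * kappa - 4 * n%:R * (n%:R - 1) * f1 p)
        / (2 * f1 p * (n%:R - 1) + f0 p) in
      flat_gives_eta_einstein n K r (quasi_conformal n f0 f1)
        f (fun p => 2 * n%:R * kappa - f p))
   /\ flat_gives_eta_einstein n K r (conformal n M)
        (fun=> 2 * n%:R - 2) (fun=> 2 * n%:R * kappa - 2 * n%:R + 2)
   /\ flat_gives_eta_einstein n K r (conharmonic n M)
        (fun=> (2 * n%:R - 1) * kappa + 4 * n%:R * (n%:R - 1))
        (fun=> kappa - 4 * n%:R * (n%:R - 1))
   /\ (let f := (2 * n%:R * (2 * n%:R - 3 + 2 * kappa) + 2)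
                / (2 * n%:R + 1) in
       flat_gives_eta_einstein n K r (concircular n M)
         (fun=> f) (fun=> 2 * n%:R * kappa - f))
   /\ (forall f0 f1 : M -> R, smooth f0 -> smooth f1 ->
      let f := fun p =>
        ((2 * n%:R - 1) * (kappa + 2 * n%:R - 2) * (2 * n%:R * f1 p + f0 p)
           / (2 * n%:R + 1)
         + kappa * f0 p)
        / (f1 p * (2 * n%:R - 1) + f0 p) in
      flat_gives_eta_einstein n K r (pseudo_projective n f0 f1)
        f (fun p => 2 * n%:R * kappa - f p))
   /\ flat_gives_einstein n K r (projective n M) (fun=> 2 * n%:R * kappa)
   /\ flat_gives_einstein n K r (W0 n M) (fun=> 2 * n%:R * kappa)
   /\ flat_gives_einstein n K r (W1_star n M) (fun=> 2 * n%:R * kappa)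
   /\ flat_gives_einstein n K r (W6 n M) (fun=> 2 * n%:R * kappa)
   /\ flat_gives_einstein n K r (W8 n M) (fun=> 2 * n%:R * kappa)
   /\ flat_gives_eta_einstein n K r (M_projective n M)
        (fun=> 2 * n%:R * (kappa + n%:R - 1) / (n%:R + 1))
        (fun=> 2 * n%:R * (n%:R * kappa - n%:R + 1) / (n%:R + 1))
   /\ flat_gives_eta_einstein n K r (W0_star n M)
        (fun=> 2 * n%:R * kappa / (4 * n%:R - 1))
        (fun=> (8 * n%:R ^+ 2 * kappa - 4 * n%:R * kappa) / (4 * n%:R - 1))
   /\ flat_gives_eta_einstein n K r (W1 n M)
        (fun=> 2 * n%:R * kappa / (4 * n%:R - 1))
        (fun=> (8 * n%:R ^+ 2 * kappa - 4 * n%:R * kappa) / (4 * n%:R - 1))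
   /\ flat_gives_eta_einstein n K r (W2 n M)
        (fun=> 2 * n%:R * (2 * n%:R - 2 + kappa) / (2 * n%:R + 1))
        (fun=> 4 * n%:R * (n%:R * kappa - n%:R + 1) / (2 * n%:R + 1))
   /\ flat_gives_eta_einstein n K r (W9 n M)
        (fun=> 2 * n%:R * (2 * n%:R - 2 + kappa) / (2 * n%:R + 1))
        (fun=> 4 * n%:R * (n%:R * kappa - n%:R + 1) / (2 * n%:R + 1))
   /\ flat_gives_eta_einstein n K r (W3 n M)
        (fun=> 2 * n%:R * (kappa - 2 * n%:R + 2) / (2 * n%:R - 1))
        (fun=> 2 * n%:R * (2 * n%:R * kappa - 2 * kappa + 2 * n%:R - 2)
               / (2 * n%:R - 1))
   /\ flat_gives_eta_einstein n K r (W4 n M)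
        (fun=> kappa) (fun=> kappa * (2 * n%:R - 1))
   /\ flat_gives_eta_einstein n K r (W5 n M)
        (fun=> kappa) (fun=> kappa * (2 * n%:R - 1))).
Proof.
split=> [a sa flat C0|rE].
  split; first exact: (phi_flat_ricci_form hN hr flat C0).
  exact: (phi_flat_eta_einstein hN hr sa flat C0).
have N1 : 1 <= n%:R :> R by rewrite ler1n.
have e1 : n%:R != 0 :> R by rewrite gt_eqF //; lra.
have e2 : 2 * n%:R - 1 != 0 :> R by rewrite gt_eqF //; lra.
have e3 : 2 * n%:R + 1 != 0 :> R by rewrite gt_eqF //; lra.
have e4 : 4 * n%:R - 1 != 0 :> R by rewrite gt_eqF //; lra.
have e5 : n%:R + 1 != 0 :> R by rewrite gt_eqF //; lra.
have sc := @smooth_const_coefs R _ M.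
split.
  move=> f0 f1 s0 s1 f; apply: (flat_gives_eta_einsteinP hN hr) => // [|p].
    exact: smooth_quasi_conformal.
  have -> : C2 n (quasi_conformal n f0 f1) p = 2 * f1 p * (n%:R - 1) + f0 p.
    by rewrite /C2 /=; ring.
  move=> C0; rewrite /f divfK // /A2 /= rE; field.
  by rewrite ?e1 ?e3.
split.
  apply: (flat_gives_eta_einsteinP hN hr (sc _ _ _ _ _ _ _ _)) => p; last by ring.
  by move=> _; rewrite /A2 /C2 /= rE; field; rewrite ?e1 ?e2.
split.
  apply: (flat_gives_eta_einsteinP hN hr (sc _ _ _ _ _ _ _ _)) => p; last by ring.
  by move=> _; rewrite /A2 /C2 /= rE; field; rewrite ?e1 ?e2.
split.
  move=> f; apply: (flat_gives_eta_einsteinP hN hr (sc _ _ _ _ _ _ _ _)) => // p.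
  by move=> _; rewrite /A2 /C2 /= /f rE; field; rewrite ?e1 ?e3.
split.
  move=> f0 f1 s0 s1 f; apply: (flat_gives_eta_einsteinP hN hr) => // [|p].
    exact: smooth_pseudo_projective.
  have -> : C2 n (pseudo_projective n f0 f1) p = f1 p * (2 * n%:R - 1) + f0 p.
    by rewrite /C2 /=; ring.
  move=> C0; rewrite /f divfK // /A2 /= rE; field.
  by rewrite ?e1 ?e3.
do 5! (split; first by apply: (flat_gives_einsteinP hN hr (sc _ _ _ _ _ _ _ _)) => p _;
  rewrite /A2 /C2 /=; field; rewrite ?e1).
split.
  apply: (flat_gives_eta_einsteinP hN hr (sc _ _ _ _ _ _ _ _)) => p; last by field; rewrite ?e5.
  by move=> _; rewrite /A2 /C2 /= rE; field; rewrite ?e1 ?e5.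
do 2! (split; first by apply: (flat_gives_eta_einsteinP hN hr (sc _ _ _ _ _ _ _ _)) => p;
  [move=> _; rewrite /A2 /C2 /= rE; field; rewrite ?e1 ?e4|field; rewrite ?e4]).
do 2! (split; first by apply: (flat_gives_eta_einsteinP hN hr (sc _ _ _ _ _ _ _ _)) => p;
  [move=> _; rewrite /A2 /C2 /= rE; field; rewrite ?e1 ?e3|field; rewrite ?e3]).
split.
  apply: (flat_gives_eta_einsteinP hN hr (sc _ _ _ _ _ _ _ _)) => p; last by field; rewrite ?e2.
  by move=> _; rewrite /A2 /C2 /= rE; field; rewrite ?e1 ?e2.
by split; (apply: (flat_gives_eta_einsteinP hN hr (sc _ _ _ _ _ _ _ _)) => p;
  [move=> _; rewrite /A2 /C2 /=; field; rewrite ?e1|ring]).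
Qed.
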